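(* Let $X=\theta^*+Z$ with arbitrary $\theta^*\in\mathbb{R}^n$ and $Z$ satisfying condition (M). For $\tau>0$ define $\mathrm{pen}_\tau(1)=\tau$ and $\mathrm{pen}_\tau(k)=\tau k\log\log(16n/k)$ for $2\le k\le n$, let $$\widehat{k}\in\arg\min_{k\in[n]}\Big\{\|X-\widehat{\theta}(\Theta_{k}^{\uparrow})\|^2+\mathrm{pen}_{\tau}(k)\Big\},$$ and $\widehat\theta=\widehat\theta(\Theta_{\widehat k}^\uparrow)$. There exist universal constants $C'>0$ and $C>0$ such that if $\tau=C'\sigma^2$, then $$\mathbb{E}\|\widehat{\theta}-\theta^*\|^2\leq C\min_{1\leq k\leq n}\Big\{\inf_{\theta\in\Theta_k^{\uparrow}}\|\theta-\theta^*\|^2 + \mathrm{pen}_{\tau}(k)\Big\}.$$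
   Context: $[n]=\{1,\dots,n\}$. For reals $a\le b$, $(a:b]$ is the set of integers $i$ with $a<i\le b$. For $k\in[n]$, $\Theta_k^{\uparrow}$ is the set of $\theta\in\mathbb{R}^n$ for which there exist integers $0=a_0\le a_1\le\cdots\le a_k=n$ and reals $\mu_1\le\cdots\le\mu_k$ with $\theta_i=\mu_j$ for all $i\in(a_{j-1}:a_j]$. $\widehat{\theta}(\Theta_k^{\uparrow})$ denotes a minimizer of $\|X-\theta\|^2$ over $\Theta_k^{\uparrow}$. Condition (M): $Z_1,\dots,Z_n$ independent, mean zero, and for some $\sigma>0$, fixed $\epsilon\in(0,1)$, fixed $C_1>0$: either (i) $\max_i\mathbb{E}|Z_i/\sigma|^{2+\epsilon}\le C_1$, or (ii) the $Z_i$ are identically distributed with $\mathbb{E}(Z_1^2/\sigma^2)\log(e+Z_1^2/\sigma^2)\le C_1$. ''Universal constants'' may depend only on $\epsilon$ and $C_1$. *)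

(* Defs.v *)
From HB Require Import structures.
From mathcomp Require Import all_boot all_order all_algebra.
From mathcomp Require Import all_classical all_reals all_analysis.
Set Implicit Arguments. Unset Strict Implicit. Unset Printing Implicit Defensive.
Import Order.TTheory GRing.Theory Num.Theory.
Local Open Scope ring_scope.
Local Open Scope classical_set_scope.

Section Defs.
Variable R : realType.

Definition sqdist (n : nat) (x y : 'I_n -> R) : R := \sum_(i < n) (x i - y i) ^+ 2.

(* Theta_k^up : nondecreasing vectors with at most k constant pieces.
   Paper index i in [n] corresponds to (i : 'I_n) with value i.+1. *)
Definition ThetaUp (n k : nat) (th : 'I_n -> R) : Prop :=
  exists (a : nat -> nat) (mu : nat -> R),
    [/\ a 0%N = 0%N, a k = n,
        (forall j, (j < k)%N -> (a j <= a j.+1)%N),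
        (forall j, (1 <= j)%N -> (j < k)%N -> mu j <= mu j.+1) &
        (forall (j : nat) (i : 'I_n), (1 <= j <= k)%N ->
            (a j.-1 < i.+1 <= a j)%N -> th i = mu j)].

Definition pen (tau : R) (n k : nat) : R :=
  if k == 1%N then tau
  else tau * k%:R * ln (ln (16 * n%:R / k%:R)).

Definition approx_err (n k : nat) (thstar : 'I_n -> R) : R :=
  inf [set r : R | exists th, ThetaUp k th /\ r = sqdist th thstar].

Definition mutually_independent d (T : measurableType d)
    (P : probability T R) (n : nat) (Z : 'I_n -> T -> R) : Prop :=
  forall B : 'I_n -> set R, (forall i, measurable (B i)) ->
    P (\bigcap_i (Z i @^-1` B i)) = (\prod_(i < n) P (Z i @^-1` B i))%E.

Definition condM d (T : measurableType d) (P : probability T R) (n : nat)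
    (Z : 'I_n -> T -> R) (sigma eps C1 : R) : Prop :=
  [/\ (forall i, measurable_fun setT (Z i)),
      mutually_independent P Z,
      (forall i, P.-integrable setT (EFin \o Z i) /\
                 (\int[P]_w (Z i w)%:E = 0)%E) &
      (forall i, (\int[P]_w (`| Z i w / sigma | `^ (2 + eps))%:E <= C1%:E)%E)
      \/
      ((forall i j B, measurable B -> P (Z i @^-1` B) = P (Z j @^-1` B)) /\
       (forall i, (\int[P]_w (((Z i w / sigma) ^+ 2) *
                    ln (expR 1 + (Z i w / sigma) ^+ 2))%:E <= C1%:E)%E))].

End Defs.

(* Main.v *)
Require Import Defs.
From HB Require Import structures.
From mathcomp Require Import all_boot all_order all_algebra.
From mathcomp Require Import all_classical all_reals all_analysis.
From mathcomp Require Import measurable_realfun.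
From mathcomp Require Import zify ring lra.
Import Order.TTheory GRing.Theory Num.Theory.
Local Open Scope ring_scope.
Local Open Scope classical_set_scope.
Set Implicit Arguments. Unset Strict Implicit. Unset Printing Implicit Defensive.

(** The selected [khat] depends on the noise, so no expectation may be taken while it is present.
    The noise bound is therefore pathwise and uniform in [khat] and the fit. It leaves one remainder
    [Q] that depends only on the oracle, and only [Q] is integrated.

    The truncation exponent 1/4 is one choice in the open interval from 0 to 1/2. Levels must grow
    geometrically for the tails to be summable over scales. They must also stay well below
    [2^(r/2)], the standard deviation of a sum of length [2^r], so that the normalised maximum is
    sub-Gaussian over a range that widens with [r].

    The case [k = khat = 1] needs its own argument: [pen 1] has no iterated logarithm, so the
    threshold is not paid for. There the two vectors differ by a constant and the variance of the
    total sum suffices. *)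

(** If [v] is nonnegative and nonincreasing and [S q] are the partial sums of
    the noise, then Abel summation bounds [<v, Z>] by
    [sum_r max_(q < 2^(r+1)) |S q| * v (2^r)], where only the dyadic scales [r]
    containing a jump of [v] contribute, while [sum_r 2^r v(2^r)^2 <= 2 |v|^2].
    Applying this to the positive and negative parts of [thhat - th] on each of
    the [k] pieces of the oracle [th], with [eta_r = max_q (S q)^2 / 2^r],
    [2 <Z, thhat - th> <= |thhat - th|^2 / 4 + 8 * sum of at most 2 (k + khat)
    of the eta_r].

    Truncating the noise at [2^(r/4)] splits [eta_r] into [A_r + B_r].  Doob's
    inequality gives [E B_r] of the order of the truncated second moment, which
    is summable over [r] under condition (M), and exponential tails for [A_r];
    since there are at most [k log(n/k)] scales, the excesses of the [A_r] over
    [c log log (16 n / k)] sum to [O(k)] in mean.  The number of scales used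
    times this threshold is paid for by the penalty, unless
    [khat > k sqrt(16 n / k)]; then already the sum of all the [A_r] is at most
    [khat] up to a term of mean [O(k)]. *)

(** * Expectations and independence *)

Section independence.
Context d (T : measurableType d) (R : realType) (P : probability T R).
Implicit Types F D : T -> R.

Definition indep_pair F D := forall A B, measurable A -> measurable B ->
  P (F @^-1` A `&` D @^-1` B) = (P (F @^-1` A) * P (D @^-1` B))%E.

Lemma indep_pair_comp F D (f g : R -> R) :
  measurable_fun setT f -> measurable_fun setT g ->
  indep_pair F D -> indep_pair (f \o F) (g \o D).
Proof.
move=> mf mg ind A B mA mB; apply: (ind (f @^-1` A) (g @^-1` B)).
- by rewrite -[X in measurable X]setTI; exact: mf.
- by rewrite -[X in measurable X]setTI; exact: mg.
Qed.

(** Independence says that the law of the pair agrees with the product of the two laws on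
    rectangles, hence everywhere; Tonelli then factorises the integral. *)
Lemma ge0_indep_integralM F D : measurable_fun setT F -> measurable_fun setT D ->
  (forall w, 0 <= F w) -> (forall w, 0 <= D w) -> indep_pair F D ->
  (\int[P]_w (F w * D w)%:E = (\int[P]_w (F w)%:E) * \int[P]_w (D w)%:E)%E.
Proof.
move=> mF mD F0 D0 ind.
pose FD w := (F w, D w).
have mFD : measurable_fun setT FD by exact: measurable_fun_pair.
pose mF' : {mfun T >-> R} := HB.pack F (isMeasurableFun.Build _ _ _ _ _ mF).
pose mD' : {mfun T >-> R} := HB.pack D (isMeasurableFun.Build _ _ _ _ _ mD).
pose mFD' : {mfun T >-> (R * R)%type} := HB.pack FD (isMeasurableFun.Build _ _ _ _ _ mFD).
(* The absolute values make the integrand nonnegative on the whole plane; on the range of [FD] they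
   change nothing. *)
pose f (z : R * R) : \bar R := (`|z.1| * `|z.2|)%:E.
have mf : measurable_fun setT f.
  apply/measurable_EFinP/measurable_funM; apply: measurableT_comp => //.
have -> : (\int[P]_w (F w * D w)%:E = \int[distribution P mFD']_z f z)%E.
  rewrite /distribution ge0_integral_pushforward//; last first.
    by move=> z _; rewrite /f lee_fin mulr_ge0.
  by apply: eq_integral => w _; rewrite /f/= !ger0_norm.
have E X : measurable X -> (distribution P mF' \x distribution P mD')%E X = distribution P mFD' X.
  move=> mX; apply: (@product_measure_unique _ _ _ _ _ (distribution P mF')
    (distribution P mD') (distribution P mFD') _ X mX) => A B mA mB /=.
  by rewrite /distribution /pushforward -(ind _ _ mA mB).
transitivity (\int[(distribution P mF' \x distribution P mD')]_z f z)%E.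
  by apply: eq_measure_integral => A mA _; exact/esym/E.
rewrite fubini_tonelli1//; last by move=> z; rewrite /f lee_fin mulr_ge0.
have -> : fubini_F (distribution P mD') f =
  fun x => ((\int[P]_w (D w)%:E) * (`|x|)%:E)%E.
  apply/funext => x; rewrite /fubini_F /f/=.
  under eq_integral do rewrite EFinM.
  rewrite ge0_integralZl//; last first.
    by apply/measurable_EFinP; exact: normr_measurable.
  rewrite muleC; congr (_ * _)%E.
  rewrite /distribution ge0_integral_pushforward//=; last first.
    by apply/measurable_EFinP; exact: normr_measurable.
  by apply: eq_integral => w _; rewrite /= ger0_norm.
rewrite ge0_integralZl//; last 2 first.
- by apply/measurable_EFinP; exact: normr_measurable.
- by apply: integral_ge0 => w _; rewrite lee_fin.
rewrite muleC; congr (_ * _)%E.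
rewrite /distribution ge0_integral_pushforward//=; last first.
  by apply/measurable_EFinP; exact: normr_measurable.
by apply: eq_integral => w _; rewrite /= ger0_norm.
Qed.

Definition itg F := P.-integrable setT (EFin \o F).

Lemma itg_measurable F : itg F -> measurable_fun setT F.
Proof. by move=> /measurable_int/measurable_EFinP. Qed.

Lemma itgP F : measurable_fun setT F -> (\int[P]_w (`|F w|)%:E < +oo)%E -> itg F.
Proof.
move=> mF lt; apply/integrableP; split; first exact/measurable_EFinP.
by under eq_integral do rewrite /= .
Qed.

Lemma itg_integral F : itg F -> (\int[P]_w (F w)%:E = (\int[P]_w F w)%:E)%E.
Proof. by move=> iF; rewrite /Rintegral fineK//; exact: integrable_fin_num. Qed.

Lemma itgD F D : itg F -> itg D -> itg (fun w => F w + D w).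
Proof. by move=> iF iD; apply: (integrableD measurableT iF iD). Qed.

Lemma itgB F D : itg F -> itg D -> itg (fun w => F w - D w).
Proof. by move=> iF iD; apply: (integrableB measurableT iF iD). Qed.

Lemma itgZ c F : itg F -> itg (fun w => c * F w).
Proof. by move=> iF; apply: (integrableZl measurableT c iF). Qed.

Lemma itg_cst c : itg (fun=> c).
Proof. exact: finite_measure_integrable_cst. Qed.

Lemma itg_sum (I : Type) (r : seq I) (f : I -> T -> R) :
  (forall i, itg (f i)) -> itg (fun w => \sum_(i <- r) f i w).
Proof.
move=> H; elim: r => [|i r IH].
  by under [X in itg X]funext do rewrite big_nil; exact: itg_cst.
by under [X in itg X]funext do rewrite big_cons; exact: itgD.
Qed.

Lemma itg_le F D : measurable_fun setT F -> itg D ->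
  (forall w, `|F w| <= D w) -> itg F.
Proof.
move=> mF iD FD; apply: (le_integrable measurableT _ _ iD).
  exact/measurable_EFinP.
by move=> w _; rewrite /= lee_fin (le_trans (FD w))// ler_norm.
Qed.

Lemma Ex_le F D : itg F -> itg D -> (forall w, F w <= D w) ->
  \int[P]_w F w <= \int[P]_w D w.
Proof. by move=> iF iD FD; apply: le_Rintegral. Qed.

Lemma ExD F D : itg F -> itg D ->
  \int[P]_w (F w + D w) = \int[P]_w F w + \int[P]_w D w.
Proof. exact: RintegralD. Qed.

Lemma ExB F D : itg F -> itg D ->
  \int[P]_w (F w - D w) = \int[P]_w F w - \int[P]_w D w.
Proof. exact: RintegralB. Qed.

Lemma ExZ c F : itg F -> \int[P]_w (c * F w) = c * \int[P]_w F w.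
Proof. exact: RintegralZl. Qed.

Lemma Ex_cst (c : R) : \int[P]_w c = c.
Proof.
have -> : \int[P]_w c = c * fine (P setT) by exact: Rintegral_cst.
by have -> : P setT = 1%E := probability_setT P; rewrite mulr1.
Qed.

(** The four products of positive and negative parts fall under the nonnegative case, which also
    makes each of them integrable. *)
Lemma indep_integralM F D : itg F -> itg D -> indep_pair F D ->
  itg (fun w => F w * D w) /\
  \int[P]_w (F w * D w) = (\int[P]_w F w) * (\int[P]_w D w).
Proof.
move=> iF iD ind.
pose pos (x : R) := Num.max x 0; pose neg (x : R) := Num.max (- x) 0.
have mpos : measurable_fun setT pos by exact: measurable_maxr.
have mneg : measurable_fun setT neg by apply: measurable_maxr => //; exact: oppr_measurable.
have key f g : (f = pos \/ f = neg) -> (g = pos \/ g = neg) ->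
    [/\ itg (f \o F), itg (g \o D), itg (fun w => f (F w) * g (D w)) &
   \int[P]_w (f (F w) * g (D w)) = (\int[P]_w f (F w)) * (\int[P]_w g (D w))].
  move=> hf hg.
  have mf : measurable_fun setT f by case: hf => ->.
  have mg : measurable_fun setT g by case: hg => ->.
  have f0 x : 0 <= f x by case: hf => ->; rewrite /pos/neg le_max lexx orbT.
  have g0 x : 0 <= g x by case: hg => ->; rewrite /pos/neg le_max lexx orbT.
  have fn x : `|f x| <= `|x|.
    by rewrite ger0_norm//; case: hf => ->; rewrite /pos/neg ge_max normr_ge0 ?ler_norm// -normrN ler_norm.
  have gn x : `|g x| <= `|x|.
    by rewrite ger0_norm//; case: hg => ->; rewrite /pos/neg ge_max normr_ge0 ?ler_norm// -normrN ler_norm.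
  have mfF : measurable_fun setT (f \o F) by apply: measurableT_comp => //; exact: itg_measurable.
  have mgD : measurable_fun setT (g \o D) by apply: measurableT_comp => //; exact: itg_measurable.
  have ifF : itg (f \o F) by apply: (itg_le mfF (integrable_norm iF)) => w; exact: fn.
  have igD : itg (g \o D) by apply: (itg_le mgD (integrable_norm iD)) => w; exact: gn.
  have E := ge0_indep_integralM mfF mgD (fun w => f0 _) (fun w => g0 _) (indep_pair_comp mf mg ind).
  have E' : (\int[P]_w (f (F w) * g (D w))%:E = ((\int[P]_w f (F w)) * (\int[P]_w g (D w)))%:E)%E.
    by rewrite [LHS]E !itg_integral// EFinM.
  split => //; last by rewrite [LHS]/Rintegral E'.
  apply: itgP; first exact: measurable_funM.
  under eq_integral do rewrite ger0_norm ?mulr_ge0//.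
  by rewrite E' ltry.
have [? ? i1 e1] := key _ _ (or_introl erefl) (or_introl erefl).
have [? ? i2 e2] := key _ _ (or_introl erefl) (or_intror erefl).
have [? ? i3 e3] := key _ _ (or_intror erefl) (or_introl erefl).
have [? ? i4 e4] := key _ _ (or_intror erefl) (or_intror erefl).
have dec x : x = pos x - neg x by rewrite /pos /neg; case: (leP x 0) => h; [rewrite max_l ?oppr_ge0// sub0r opprK | rewrite max_r ?oppr_le0 ?ltW// subr0].
have EF : (fun w => F w * D w) = (fun w =>
  (pos (F w) * pos (D w) - pos (F w) * neg (D w)) -
  (neg (F w) * pos (D w) - neg (F w) * neg (D w))).
  by apply/funext => w; rewrite {1}(dec (F w)) {1}(dec (D w)); ring.
have i12 := itgB i1 i2; have i34 := itgB i3 i4.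
split; first by rewrite EF; exact: itgB.
rewrite EF (ExB i12 i34) (ExB i1 i2) (ExB i3 i4) e1 e2 e3 e4.
have -> : \int[P]_w F w = \int[P]_w pos (F w) - \int[P]_w neg (F w).
  by rewrite -RintegralB//; congr Rintegral; apply/funext => w; exact: dec.
have -> : \int[P]_w D w = \int[P]_w pos (D w) - \int[P]_w neg (D w).
  by rewrite -RintegralB//; congr Rintegral; apply/funext => w; exact: dec.
ring.
Qed.

End independence.

(** * Independence of a term from the past of its sequence *)

Section sequences.
Context d (T : measurableType d) (R : realType) (P : probability T R).
Variable X : nat -> T -> R.

Definition cylinder k (B : nat -> set R) :=
  [set w | forall p, (p < k)%N -> B p (X p w)].

Definition cylinders k : set (set T) :=
  [set A | exists2 B, (forall p, measurable (B p)) & A = cylinder k B].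

(** Initial segments are enough: taking some [B p] to be [setT] recovers every subfamily. *)
Definition seq_indep m := forall k, (k <= m)%N ->
  forall B, (forall p, measurable (B p)) ->
  P (cylinder k B) = (\prod_(p < k) P (X p @^-1` B p))%E.

(** Carrying the sigma-algebra of the first [k] terms in the type turns adaptedness into plain
    measurability, so the closure lemmas for sums and maxima apply to it. *)
Definition past k := g_sigma_algebraType (cylinders k).

Definition adapted k (F : T -> R) := measurable_fun (setT : set (past k)) F.

Hypothesis mX : forall p, measurable_fun setT (X p).

Lemma measurable_cylinder k B : (forall p, measurable (B p)) ->
  measurable (cylinder k B).
Proof.
move=> mB.
have -> : cylinder k B = \bigcap_(p in [set p | (p < k)%N]) (X p @^-1` B p).
  by apply/seteqP; split.
apply: bigcap_measurableType => p _.
by rewrite -[X in measurable X]setTI; exact: mX.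
Qed.

Lemma setI_closed_cylinders k : setI_closed (cylinders k).
Proof.
move=> _ _ [A mA ->] [B mB ->]; exists (fun p => A p `&` B p).
  by move=> p; exact: measurableI.
apply/seteqP; split => w /=; first by move=> [a b] p pk; split; [exact: a|exact: b].
by move=> ab; split=> p pk; have [] := ab p pk.
Qed.

Lemma past_measurable k A : <<s cylinders k >> A -> measurable A.
Proof.
move: A; apply: smallest_sub; first exact: sigma_algebra_measurable.
by move=> _ [B mB ->]; exact: measurable_cylinder.
Qed.

Lemma adapted_measurable k F : adapted k F -> measurable_fun setT F.
Proof.
move=> aF _ A mA; have := aF measurableT A mA; rewrite !setTI.
exact: past_measurable.
Qed.

Lemma adapted_X k p : (p < k)%N -> adapted k (X p).
Proof.
move=> pk _ A mA; rewrite setTI; apply: sub_sigma_algebra.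
exists (fun q => if q == p then A else setT).
  by move=> q; case: ifP.
apply/seteqP; split => w /=.
  by move=> Aw q qk; case: eqP => // ->.
by move=> /(_ p pk); rewrite eqxx.
Qed.

(** Dynkin's argument: the events that factorise with a fixed event of [X k] form a lambda-system,
    and it contains the cylinders, which are closed under intersection and generate the past. *)
Lemma past_indep m k F : seq_indep m -> (k < m)%N -> adapted k F ->
  indep_pair P F (X k).
Proof.
move=> ind km aF A B mA mB.
have : <<s cylinders k >> (F @^-1` A).
  by have := aF measurableT A mA; rewrite setTI.
have mC : measurable (X k @^-1` B).
  by rewrite -[X in measurable X]setTI; exact: mX.
move: (F @^-1` A) => {A mA F aF}.
pose Q := [set A : set T | measurable A /\
  (P (A `&` X k @^-1` B) = P A * P (X k @^-1` B))%E].
suff HQ : <<s cylinders k >> `<=` Q by move=> A /HQ[].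
apply: lambda_system_subset => //; first exact: setI_closed_cylinders.
  apply/dynkin_lambda_system; split.
  - by split => //; rewrite setTI probability_setT mul1e.
  - move=> S [mS H]; split; first exact: measurableC.
    have -> : ~` S `&` X k @^-1` B = X k @^-1` B `\` S by rewrite setDE setIC.
    rewrite measureD//; last exact: (le_lt_trans (probability_le1 _ _) (ltry _)).
    rewrite [X in (_ - X)%E](_ : _ = P S * P (X k @^-1` B))%E; last first.
      by rewrite setIC; exact: H.
    rewrite probability_setC// muleBl ?mul1e ?fin_num_measure//.
  - move=> S tS mQ; split; first by apply: bigcupT_measurable => n; have [] := mQ n.
    rewrite setI_bigcupl !measure_bigcup//; last 3 first.
    + by move=> n _; have [] := mQ n.
    + by move=> n _; apply: measurableI => //; have [] := mQ n.
    + exact: trivIset_setIr.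
    rewrite muleC -(@fineK _ (P (X k @^-1` B))) ?fin_num_measure// -nneseriesZl//.
    apply: eq_eseriesr => n _; rewrite fineK ?fin_num_measure// muleC.
    by have [] := mQ n.
move=> _ [D mD ->]; split; first exact: measurable_cylinder.
pose D' p := if p == k then B else D p.
have mD' p : measurable (D' p) by rewrite /D'; case: ifP.
have -> : cylinder k D `&` X k @^-1` B = cylinder k.+1 D'.
  apply/seteqP; split => w /=.
    move=> [H1 H2] p; rewrite ltnS leq_eqVlt => /orP[/eqP->|pk].
      by rewrite /D' eqxx.
    by rewrite /D' ltn_eqF//; exact: H1.
  move=> H; split; last by have := H k (ltnSn k); rewrite /D' eqxx.
  by move=> p pk; have := H p (ltnW pk); rewrite /D' ltn_eqF.
rewrite ind// ind//; last exact: ltnW.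
rewrite big_ord_recr/= /D' eqxx; congr (_ * _)%E.
by apply: eq_bigr => i _; rewrite ltn_eqF.
Qed.

End sequences.

(** * Maximal inequalities for sums of independent variables *)

Section running_maximum.
Context {R : realType}.
Implicit Types s : nat -> R.

Fixpoint runmax s k : R :=
  if k is k'.+1 then Num.max (runmax s k') (s k) else s 0%N.

Lemma le_runmax s i k : (i <= k)%N -> s i <= runmax s k.
Proof.
elim: k => [|k IH]; first by rewrite leqn0 => /eqP ->.
rewrite leq_eqVlt => /orP[/eqP->|ik]; rewrite /= le_max ?lexx ?orbT//.
by rewrite IH.
Qed.

Lemma runmax_le s k x : (forall i, (i <= k)%N -> s i <= x) -> runmax s k <= x.
Proof.
elim: k => [|k IH] H /=; first exact: H.
by rewrite ge_max H// IH// => i ik; rewrite H// ltnW.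
Qed.

Lemma runmax_homo (f : R -> R) s k : {homo f : x y / x <= y} ->
  runmax (f \o s) k = f (runmax s k).
Proof.
move=> hf; elim: k => //= k ->.
case: (leP (runmax s k) (s k.+1)) => h; first by rewrite max_r// hf.
by rewrite max_l// hf// ltW.
Qed.

(* The deterministic form of Doob's L^2 inequality: the sum becomes
   nonnegative in mean for a submartingale. *)
Lemma doob_pathwise s n :
  runmax s n ^+ 2 + 4 * \sum_(i < n) runmax s i * (s i.+1 - s i) <= 4 * s n ^+ 2.
Proof.
(* This form is stable under induction: a new maximum costs a square, otherwise both sides grow
   equally. The claim follows from it by [(runmax - 2 s)^2 >= 0]. *)
have H : runmax s n ^+ 2 / 2 + \sum_(i < n) runmax s i * (s i.+1 - s i)
    <= runmax s n * s n.
  elim: n => [|n IH]; first by rewrite big_ord0 /=; nra.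
  rewrite big_ord_recr/=; move: IH.
  set b := runmax s n; set S := \sum_(i < n) _ => IH.
  by case: (leP b (s n.+1)) => h; nra.
by move: H; set b := runmax s n; set S := \sum_(i < n) _ => H; have := sqr_ge0 (b - 2 * s n); nra.
Qed.

(** From [expR (- x) >= 1 - x] one gets [expR x <= 1 / (1 - x)], and [(1 + x + 2 x^2) (1 - x) = 1 +
    x^2 (1 - 2 x) >= 1]. *)
Lemma expR_le_quadratic (x : R) : `|x| <= 2^-1 -> expR x <= 1 + x + 2 * x ^+ 2.
Proof.
rewrite ler_norml => /andP[x1 x2].
have h := expR_ge1Dx (- x).
have e0 := expR_gt0 x.
have : expR x * (1 - x) <= 1.
  by rewrite -[leRHS](@expRxMexpNx_1 _ x) ler_pM2l.
move=> h2.
have h3 : 1 <= (1 + x + 2 * x ^+ 2) * (1 - x) by nra.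
rewrite -(@ler_pM2r _ (1 - x)); last by lra.
exact: (le_trans h2 h3).
Qed.

End running_maximum.

Section maximal_inequalities.
Context d (T : measurableType d) (R : realType) (P : probability T R).

Lemma itg_bounded (c : R) (F : T -> R) : measurable_fun setT F ->
  (forall w, `|F w| <= c) -> itg P F.
Proof. by move=> mF Fc; exact: itg_le mF (itg_cst P c) Fc. Qed.

Lemma adapted_runmax (X M : nat -> T -> R) k :
  (forall i, (i <= k)%N -> adapted X k (M i)) ->
  adapted X k (fun w => runmax (M ^~ w) k).
Proof.
move=> H; suff : forall j, (j <= k)%N -> adapted X k (fun w => runmax (M ^~ w) j).
  exact.
elim=> [|j IH] jk /=; first exact: H.
by apply: measurable_maxr; [exact: IH (ltnW jk)|exact: H].
Qed.

(** Integrates [doob_pathwise]. The submartingale property enters only as the sign of the mean of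
    maximum times increment, which covers both the partial sums and their exponentials. *)
Lemma doob_L2 (M : nat -> T -> R) m :
  (forall i, (i < m)%N -> itg P (fun w => runmax (M ^~ w) i * (M i.+1 w - M i w)) /\
     0 <= \int[P]_w (runmax (M ^~ w) i * (M i.+1 w - M i w))) ->
  measurable_fun setT (fun w => runmax (M ^~ w) m) ->
  itg P (fun w => M m w ^+ 2) ->
  itg P (fun w => runmax (M ^~ w) m ^+ 2) /\
  \int[P]_w (runmax (M ^~ w) m ^+ 2) <= 4 * \int[P]_w (M m w ^+ 2).
Proof.
move=> H mM iM.
pose S k w := \sum_(i < k) runmax (M ^~ w) i * (M i.+1 w - M i w).
have HS k : (k <= m)%N -> itg P (S k) /\ 0 <= \int[P]_w S k w.
  elim: k => [|k IH] km.
    rewrite (_ : S 0%N = fun=> 0); last by apply/funext => w; rewrite /S big_ord0.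
    by split; [exact: itg_cst|rewrite Rintegral_cst// mul0r].
  have [i1 e1] := IH (ltnW km); have [i2 e2] := H _ km.
  rewrite (_ : S k.+1 = fun w => S k w + runmax (M ^~ w) k * (M k.+1 w - M k w)).
    by split; [exact: itgD|rewrite RintegralD//; exact: addr_ge0].
  by apply/funext => w; rewrite /S big_ord_recr.
have [iS S0] := HS m (leqnn m).
pose D w := 4 * M m w ^+ 2 - 4 * S m w.
have iD : itg P D by apply: itgB; exact: itgZ.
have le w : runmax (M ^~ w) m ^+ 2 <= D w.
  by rewrite lerBrDr; exact: doob_pathwise.
have iR : itg P (fun w => runmax (M ^~ w) m ^+ 2).
  apply: (itg_le _ iD); first exact: measurable_funX.
  by move=> w; rewrite ger0_norm ?sqr_ge0.
split => //; apply: (le_trans (Ex_le iR iD le)).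
rewrite RintegralB//; [|exact: itgZ|exact: itgZ].
by rewrite !RintegralZl//; lra.
Qed.

Variable X : nat -> T -> R.
Hypothesis mX : forall p, measurable_fun setT (X p).

Definition psum k w := \sum_(p < k) X p w.

Lemma psumS k w : psum k.+1 w = psum k w + X k w.
Proof. by rewrite /psum big_ord_recr. Qed.

Lemma adapted_psum k i : (i <= k)%N -> adapted X k (psum i).
Proof.
elim: i => [|i IH] ik.
  rewrite (_ : psum 0 = cst 0); first exact: measurable_cst.
  by apply/funext => w; rewrite /psum big_ord0.
rewrite (_ : psum i.+1 = psum i \+ X i); last by apply/funext => w; exact: psumS.
by apply: measurable_funD; [exact: IH (ltnW ik)|exact: adapted_X].
Qed.

Lemma indep_past_mul m k F (h : R -> R) : seq_indep P X m -> (k < m)%N ->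
  adapted X k F -> measurable_fun setT h -> itg P F -> itg P (h \o X k) ->
  itg P (fun w => F w * h (X k w)) /\
  \int[P]_w (F w * h (X k w)) = (\int[P]_w F w) * (\int[P]_w h (X k w)).
Proof.
move=> ind km aF mh iF ih; apply: indep_integralM => //.
have := past_indep mX ind km aF.
by apply: (@indep_pair_comp _ _ _ _ _ _ id).
Qed.

Section L2.
Variable m : nat.
Hypothesis ind : seq_indep P X m.
Hypothesis iX : forall p, itg P (X p).
Hypothesis EX : forall p, \int[P]_w X p w = 0.
Hypothesis iX2 : forall p, itg P (fun w => X p w ^+ 2).

Lemma itg_psum k : itg P (psum k).
Proof.
elim: k => [|k IH].
  by rewrite (_ : psum 0 = fun=> 0); [exact: itg_cst|apply/funext => w; rewrite /psum big_ord0].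
rewrite (_ : psum k.+1 = fun w => psum k w + X k w); last by apply/funext => w; exact: psumS.
exact: itgD.
Qed.

Lemma psum_sq k : (k <= m)%N -> itg P (fun w => psum k w ^+ 2) /\
  \int[P]_w (psum k w ^+ 2) = \sum_(p < k) \int[P]_w (X p w ^+ 2).
Proof.
elim: k => [|k IH] km.
  rewrite (_ : (fun w => psum 0 w ^+ 2) = fun=> 0).
    by split; [exact: itg_cst|rewrite Rintegral_cst// mul0r big_ord0].
  by apply/funext => w; rewrite /psum big_ord0 expr0n.
have [i1 e1] := IH (ltnW km).
have [i2 e2] := @indep_past_mul m k (psum k) id ind km (adapted_psum (leqnn k))
  (@measurable_id _ _ _) (itg_psum k) (iX k).
rewrite (_ : (fun w => psum k.+1 w ^+ 2) =
  fun w => psum k w ^+ 2 + 2 * (psum k w * X k w) + X k w ^+ 2); last first.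
  by apply/funext => w; rewrite psumS; ring.
have i3 := itgZ 2 i2; have i4 := itgD i1 i3; have i5 := itgD i4 (iX2 k).
split => //.
rewrite (ExD i4 (iX2 k)) (ExD i1 i3) (ExZ 2 i2) e2 EX e1 mulr0 mulr0 addr0.
by rewrite big_ord_recr.
Qed.

Lemma psum_max_sq :
  itg P (fun w => runmax (psum ^~ w) m ^+ 2) /\
  \int[P]_w (runmax (psum ^~ w) m ^+ 2) <= 4 * \sum_(p < m) \int[P]_w (X p w ^+ 2).
Proof.
have [i1 e1] := psum_sq (leqnn m); rewrite -e1.
have ar k : adapted X k (fun w => runmax (psum ^~ w) k).
  by apply: adapted_runmax => i; exact: adapted_psum.
apply: doob_L2 => //; last by have := adapted_measurable mX (ar m).
move=> i im.
have ir : itg P (fun w => runmax (psum ^~ w) i).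
  have iA : itg P (fun w => \sum_(p < i) `|X p w|).
    by apply: itg_sum => p; apply: integrable_norm; exact: iX.
  apply: (itg_le (adapted_measurable mX (ar i)) iA) => w.
  (* The empty sum is one of the terms of the maximum. *)
  have le0 : 0 <= runmax (psum ^~ w) i.
    by rewrite -[0](_ : psum 0 w = 0) ?le_runmax// /psum big_ord0.
  rewrite ger0_norm//; apply: runmax_le => j ji.
  apply: (le_trans (ler_norm _)); apply: (le_trans (ler_norm_sum _ _ _)).
  by rewrite -(subnKC ji) big_split_ord/= lerDl sumr_ge0.
have [i2 e2] := @indep_past_mul m i _ id ind im (ar i) (@measurable_id _ _ _) ir (iX i).
rewrite (_ : (fun w => _) = (fun w => runmax (psum ^~ w) i * X i w)).
  by rewrite e2 EX mulr0; split.
by apply/funext => w; rewrite psumS addrC addKr.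
Qed.

End L2.

Section exponential.
Variables (m : nat) (b v : R).
Hypothesis ind : seq_indep P X m.
Hypothesis EX : forall p, \int[P]_w X p w = 0.
Hypothesis Xb : forall p w, `|X p w| <= b.
Hypothesis Xv : forall p, \int[P]_w (X p w ^+ 2) <= v.

Let v0 : 0 <= v.
Proof. by apply: (le_trans _ (Xv 0)); apply: Rintegral_ge0 => w _; exact: sqr_ge0. Qed.

Let psum_b k w : `|psum k w| <= k%:R * b.
Proof.
elim: k => [|k IH]; first by rewrite /psum big_ord0 normr0 mul0r.
by rewrite psumS -natr1 mulrDl mul1r (le_trans (ler_normD _ _))// lerD.
Qed.

Let b0 : 0 <= b.
Proof. exact: le_trans (normr_ge0 _) (Xb 0 point). Qed.

Let mexp s : measurable_fun setT (fun x : R => expR (s * x)).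
Proof. by apply: measurableT_comp => //; exact: mulrl_measurable. Qed.

Let iexp s k : 0 <= s -> itg P (fun w => expR (s * psum k w)).
Proof.
move=> s0; apply: (@itg_bounded (expR (s * (k%:R * b)))).
  by apply: measurableT_comp (mexp s) _; exact: (adapted_measurable mX (adapted_psum (leqnn k))).
move=> w; rewrite ger0_norm ?expR_ge0// ler_expR ler_wpM2l//.
exact: le_trans (ler_norm _) (psum_b k w).
Qed.

Let iX p : itg P (X p).
Proof. exact: itg_bounded (mX p) (Xb p). Qed.

Let iX2 p : itg P (fun w => X p w ^+ 2).
Proof.
apply: (@itg_bounded (b ^+ 2)); first exact: measurable_funX.
by move=> w; rewrite normrX lerXn2r// nnegrE.
Qed.

Let iexpX s p : 0 <= s -> itg P (fun w => expR (s * X p w)).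
Proof.
move=> s0; apply: (@itg_bounded (expR (s * b))).
  by apply: measurableT_comp (mexp s) _.
move=> w; rewrite ger0_norm ?expR_ge0// ler_expR ler_wpM2l//.
exact: le_trans (ler_norm _) (Xb p w).
Qed.

(** Each term contributes a factor at most [1 + 2 t^2 v]: [t * b <= 1/2] allows the quadratic bound
    on [expR], and its linear part has mean zero. *)
Lemma psum_mgf t k : 0 <= t -> t * b <= 2^-1 -> (k <= m)%N ->
  \int[P]_w expR (t * psum k w) <= expR (2 * t ^+ 2 * v * k%:R).
Proof.
move=> t0 tb; elim: k => [|k IH] km.
  rewrite (_ : (fun w => _) = fun=> 1) ?Ex_cst ?mulr0 ?expR0//.
  by apply/funext => w; rewrite /psum big_ord0 mulr0 expR0.
have [i2 e2] := @indep_past_mul m k (fun w => expR (t * psum k w))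
  (fun x => expR (t * x)) ind km
  (measurableT_comp (mexp t) (adapted_psum (leqnn k))) (mexp t) (iexp k t0) (iexpX k t0).
rewrite (_ : (fun w => expR (t * psum k.+1 w)) =
    fun w => expR (t * psum k w) * expR (t * X k w)); last first.
  by apply/funext => w; rewrite psumS mulrDr expRD.
rewrite e2 -[k.+1%:R]natr1 mulrDr mulr1 expRD ler_pM//.
- by apply: Rintegral_ge0 => w _; exact: expR_ge0.
- by apply: Rintegral_ge0 => w _; exact: expR_ge0.
- exact: IH (ltnW km).
have iD : itg P (fun w => 1 + t * X k w + (2 * t ^+ 2) * X k w ^+ 2).
  by apply: itgD; [apply: itgD; [exact: itg_cst|exact: itgZ]|exact: itgZ].
apply: (le_trans (Ex_le (iexpX k t0) iD _)).
  move=> w; rewrite -mulrA -exprMn; apply: expR_le_quadratic.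
  by rewrite normrM ger0_norm// (le_trans _ tb)// ler_wpM2l.
rewrite ExD; [|by apply: itgD; [exact: itg_cst|exact: itgZ]|exact: itgZ].
rewrite ExD; [|exact: itg_cst|exact: itgZ].
rewrite !ExZ// Ex_cst EX mulr0 addr0.
apply: le_trans (expR_ge1Dx _); rewrite lerD2l ler_wpM2l//.
by rewrite mulr_ge0// sqr_ge0.
Qed.

Lemma psum_max_mgf t : 0 <= t -> t * b <= 2^-1 ->
  itg P (fun w => expR (t * runmax (psum ^~ w) m)) /\
  \int[P]_w expR (t * runmax (psum ^~ w) m) <= 4 * expR (2 * t ^+ 2 * v * m%:R).
Proof.
move=> t0 tb.
(* The L2 inequality is applied to [expR (s * psum)], whose square is the exponential with parameter
   [t]. *)
pose s := t / 2; have s0 : 0 <= s by rewrite divr_ge0.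
have ts : t = s *+ 2 by rewrite /s -mulr_natr divfK.
pose M k w := expR (s * psum k w).
have RM w k : runmax (M ^~ w) k = expR (s * runmax (psum ^~ w) k).
  apply: (@runmax_homo _ (fun x => expR (s * x)) (psum ^~ w)).
  by move=> x y xy; rewrite ler_expR ler_wpM2l.
have sq x : expR (t * x) = expR (s * x) ^+ 2 by rewrite ts -expRM_natr mulrnAl mulr_natr.
have am k i : (i <= k)%N -> adapted X k (M i).
  by move=> ik; exact: measurableT_comp (mexp s) (adapted_psum ik).
have ar k : adapted X k (fun w => runmax (M ^~ w) k).
  by apply: adapted_runmax => i; exact: am.
rewrite (_ : (fun w => expR (t * runmax (psum ^~ w) m)) =
    fun w => runmax (M ^~ w) m ^+ 2); last by apply/funext => w; rewrite sq RM.
have eM : (fun w => M m w ^+ 2) = fun w => expR (t * psum m w).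
  by apply/funext => w; rewrite sq.
have [|||i1 e1] := @doob_L2 M m; last first.
- split => //; apply: (le_trans e1).
  by rewrite ler_pM2l// eM; exact: psum_mgf.
- by rewrite eM; exact: iexp.
- by have := adapted_measurable mX (ar m).
- move=> i im.
  have aF : adapted X i (fun w => runmax (M ^~ w) i * M i w).
    by apply: measurable_funM; [exact: ar|exact: am].
  have iF : itg P (fun w => runmax (M ^~ w) i * M i w).
    apply: (@itg_bounded (expR (s * (i%:R * b)) * expR (s * (i%:R * b)))).
      exact: (adapted_measurable mX aF).
    move=> w; rewrite ger0_norm; last by rewrite RM mulr_ge0 ?expR_ge0.
    rewrite ler_pM ?RM ?expR_ge0 ?ler_expR ?ler_wpM2l//; last first.
      exact: le_trans (ler_norm _) (psum_b i w).
    apply: runmax_le => j ji; apply: (le_trans (ler_norm _)).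
    by apply: (le_trans (psum_b j w)); rewrite ler_wpM2r// ler_nat.
  have mh : measurable_fun setT (fun x : R => expR (s * x) - 1).
    by apply: measurable_funB; [exact: mexp|exact: measurable_cst].
  have ih : itg P (fun w => expR (s * X i w) - 1).
    by apply: itgB; [exact: iexpX|exact: itg_cst].
  have [i2 e2] := @indep_past_mul m i _ (fun x => expR (s * x) - 1) ind im aF mh iF ih.
  rewrite (_ : (fun w => _) = (fun w => runmax (M ^~ w) i * M i w * (expR (s * X i w) - 1))); last first.
    by apply/funext => w; rewrite /M psumS [s * (_ + _)]mulrDr expRD; ring.
  split => //; rewrite e2 mulr_ge0//.
    by apply: Rintegral_ge0 => w _; rewrite RM mulr_ge0 ?expR_ge0.
  (* Submartingale property: [E (expR (s X) - 1) >= s E X = 0]. *)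
  rewrite -(mulr0 s) -(EX i) -(ExZ s (iX i)); apply: Ex_le => //; first exact: itgZ.
  by move=> w; rewrite lerBrDr addrC expR_ge1Dx.
Qed.

End exponential.
End maximal_inequalities.

(** * Truncation at one dyadic scale *)

Section level.
Context d (T : measurableType d) (R : realType) (P : probability T R).

Lemma seq_indep_comp (X : nat -> T -> R) (h : nat -> R -> R) m :
  (forall p, measurable_fun setT (h p)) ->
  seq_indep P X m -> seq_indep P (fun p => h p \o X p) m.
Proof.
move=> mh ind k km B mB; apply: (ind k km (fun p => h p @^-1` B p)) => p.
by rewrite -[X in measurable X]setTI; exact: mh.
Qed.

Lemma sq_centered_le (F : T -> R) : itg P F -> itg P (fun w => F w ^+ 2) ->
  itg P (fun w => (F w - \int[P]_w' F w') ^+ 2) /\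
  \int[P]_w ((F w - \int[P]_w' F w') ^+ 2) <= \int[P]_w (F w ^+ 2).
Proof.
move=> i1 i2; set c := \int[P]_w' F w'.
have i3 := itgZ (2 * c) i1; have i4 := itgB i2 i3; have i5 := itg_cst P (c ^+ 2).
rewrite (_ : (fun w => (F w - c) ^+ 2) = fun w => F w ^+ 2 - 2 * c * F w + c ^+ 2).
  split; first exact: itgD.
  rewrite (ExD i4 i5) (ExB i2 i3) (ExZ _ i1) Ex_cst -/c.
  by rewrite -subr_ge0 (_ : _ - _ = c ^+ 2) ?sqr_ge0//; ring.
by apply/funext => w; ring.
Qed.

(** From [V^4 <= 4! * 4^4 * expR (V / 4)] and the bound [4 * expR (v / 4)] on the moment generating
    function at [s = 1/4], a point that is admissible because [b >= 1]. *)
Definition mom4 (v : R) : R := 96 * 256 * expR (v / 4).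

Lemma mom4_ge0 v : 0 <= mom4 v.
Proof. by apply: mulr_ge0 (expR_ge0 _); apply: mulr_ge0; exact: ler0n. Qed.

Section subgaussian_moments.
Variables (V : T -> R) (b v : R).
Hypotheses (b1 : 1 <= b) (v1 : 1 <= v) (mV : measurable_fun setT V).
Hypothesis V0 : forall w, 0 <= V w.
Hypothesis mgf : forall s, 0 <= s -> s <= b / 4 ->
  itg P (fun w => expR (s * V w)) /\
  \int[P]_w expR (s * V w) <= 4 * expR (4 * v * s ^+ 2).

Lemma subgaussian_mom4 : itg P (fun w => V w ^+ 4) /\
  \int[P]_w (V w ^+ 4) <= mom4 v.
Proof.
have b1' := b1.
have [||i e] := mgf (s := 4^-1); [by []|lra|].
have le w : V w ^+ 4 <= (24 * 256) * expR (4^-1 * V w).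
  have h0 : 0 <= 4^-1 * V w by rewrite mulr_ge0.
  have := @expR_ge1Dxn _ _ 3 h0; rewrite exprMn (_ : 4`!%:R = 24 :> R) //.
  by move: (expR _) (V w ^+ 4) => E W; lra.
have iZ := itgZ (24 * 256) i.
have iV : itg P (fun w => V w ^+ 4).
  apply: (itg_le _ iZ); first exact: measurable_funX.
  by move=> w; rewrite ger0_norm// exprn_ge0.
split => //; apply: (le_trans (Ex_le iV iZ le)); rewrite (ExZ _ i).
rewrite /mom4; move: e; rewrite (_ : 4 * v * 4^-1 ^+ 2 = v / 4); last by field.
by move: (expR _) (\int[P]_w _) => E I; lra.
Qed.

(* At [s = 4 * sqrt l] the moment generating function costs [64 * v * l] in the
   exponent, and the threshold [22 * v * sqrt l] gains [66 * v * l].  This [s] is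
   admissible only if [16 * sqrt l <= b]; otherwise [1 / l = O(b ^- 2)] and the
   fourth moment suffices. *)
Lemma subgaussian_excess (l : R) : 2^-1 <= l ->
  itg P (fun w => Num.max (V w ^+ 2 - (22 * v) ^+ 2 * l) 0) /\
  \int[P]_w Num.max (V w ^+ 2 - (22 * v) ^+ 2 * l) 0 <=
    16 * expR (- l) + 256 * mom4 v / b ^+ 2.
Proof.
move=> l2; have l0 : 0 < l by lra.
have b1' := b1; have v1' := v1.
set f := fun w => _.
have mf : measurable_fun setT f.
  apply: measurable_maxr => //; apply: measurable_funB => //.
  exact: measurable_funX.
have f0 w : 0 <= f w by rewrite /f le_max lexx orbT.
have q0 : 0 < Num.sqrt l by rewrite sqrtr_gt0.
have ql : Num.sqrt l ^+ 2 = l by rewrite sqr_sqrtr// ltW.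
have [i4 e4] := subgaussian_mom4.
have K0 : 0 <= mom4 v by exact: mom4_ge0.
have b0 : 0 < b ^+ 2 by rewrite exprn_gt0//; lra.
have K2 : 0 <= 256 * mom4 v / b ^+ 2.
  by apply: divr_ge0; [apply: mulr_ge0 K0; exact: ler0n|exact: ltW].
have [bl|bl] := leP (16 * Num.sqrt l) b.
  have [||i e] := mgf (s := 4 * Num.sqrt l); [by rewrite mulr_ge0// ltW|lra|].
  have iZ := itgZ (4 * expR (- (66 * v * l))) i.
  have le w : f w <= 4 * expR (- (66 * v * l)) * expR (4 * Num.sqrt l * V w).
    rewrite /f ge_max; apply/andP; split; last by rewrite !mulr_ge0// expR_ge0.
    have [h|h] := leP (V w) (22 * v * Num.sqrt l).
      apply: (@le_trans _ _ 0); last by rewrite !mulr_ge0// expR_ge0.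
      by rewrite subr_le0 -[X in _ <= _ * X]ql -exprMn lerXn2r// nnegrE// !mulr_ge0//; lra.
    apply: (@le_trans _ _ (V w ^+ 2)).
      by rewrite gerBl mulr_ge0// ?sqr_ge0// ltW.
    (* One of the four copies of [sqrt l * V] in the exponent absorbs the factor [V^2]; the other
       three exceed [66 * v * l] above the threshold. *)
    apply: (@le_trans _ _ (4 * expR (Num.sqrt l * V w))).
      have h0 : 0 <= Num.sqrt l * V w by rewrite mulr_ge0// ltW.
      have := @expR_ge1Dxn _ _ 1 h0; rewrite exprMn ql (_ : 2`!%:R = 2 :> R) //.
      have : 2^-1 * V w ^+ 2 <= l * V w ^+ 2 by rewrite ler_wpM2r// sqr_ge0.
      by move: (expR _) (l * V w ^+ 2) (V w ^+ 2) => E W W2; lra.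
    rewrite -mulrA ler_pM2l// -expRD ler_expR.
    have : 22 * v * Num.sqrt l * Num.sqrt l <= V w * Num.sqrt l.
      by rewrite ler_pM2r// ltW.
    by rewrite -mulrA -expr2 ql; lra.
  have iF : itg P f.
    by apply: (itg_le mf iZ) => w; rewrite ger0_norm.
  split => //; apply: (le_trans (Ex_le iF iZ le)); rewrite (ExZ _ i).
  apply: (@le_trans _ _ (16 * expR (- l))); last by rewrite lerDl.
  apply: (@le_trans _ _ (4 * expR (- (66 * v * l)) * (4 * expR (4 * v * (4 * Num.sqrt l) ^+ 2)))).
    by rewrite ler_wpM2l// mulr_ge0// expR_ge0.
  rewrite (_ : _ * _ = 16 * (expR (- (66 * v * l)) * expR (4 * v * (4 * Num.sqrt l) ^+ 2))).
    rewrite ler_pM2l// -expRD ler_expR exprMn ql; nra.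
  by ring.
have iZ := itgZ (256 / b ^+ 2) i4.
have le w : f w <= 256 / b ^+ 2 * V w ^+ 4.
  have V4 : 0 <= V w ^+ 4 by rewrite exprn_ge0.
  have cb : 0 <= 256 / b ^+ 2 * V w ^+ 4.
    by apply: mulr_ge0 V4; apply: divr_ge0; [exact: ler0n|exact: ltW].
  rewrite /f ge_max; apply/andP; split; last exact: cb.
  have [h|h] := leP (V w ^+ 2) ((22 * v) ^+ 2 * l).
    apply: (@le_trans _ _ 0); first by rewrite subr_le0.
    exact: cb.
  apply: (@le_trans _ _ (V w ^+ 2)).
    by rewrite gerBl mulr_ge0// ?sqr_ge0// ltW.
  rewrite mulrAC ler_pdivlMr// (_ : V w ^+ 4 = V w ^+ 2 * V w ^+ 2); last by ring.
  rewrite [leRHS]mulrCA; apply: ler_wpM2l; first exact: sqr_ge0.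
  have bl2 : b ^+ 2 <= 256 * l.
    rewrite -ql (_ : 256 * _ = (16 * Num.sqrt l) ^+ 2); last by ring.
    by rewrite lerXn2r// ?nnegrE ?ltW// ?mulr_gt0//; lra.
  have : l <= (22 * v) ^+ 2 * l by rewrite ler_peMl// ?ltW//; nra.
  by lra.
have iF : itg P f.
  by apply: (itg_le mf iZ) => w; rewrite ger0_norm.
split => //; apply: (le_trans (Ex_le iF iZ le)); rewrite (ExZ _ i4).
apply: (@le_trans _ _ (256 * mom4 v / b ^+ 2)).
  rewrite mulrAC; apply: ler_wpM2r; first by rewrite invr_ge0 ltW.
  by apply: ler_wpM2l e4; exact: ler0n.
by rewrite lerDr mulr_ge0// expR_ge0.
Qed.

End subgaussian_moments.

Lemma runmax_psum_ge0 (Y : nat -> T -> R) m w : 0 <= runmax (psum Y ^~ w) m.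
Proof. by rewrite -[leLHS](_ : psum Y 0 w = 0) ?le_runmax// /psum big_ord0. Qed.

Lemma measurable_runmax_psum (Y : nat -> T -> R) m :
  (forall p, measurable_fun setT (Y p)) ->
  measurable_fun setT (fun w => runmax (psum Y ^~ w) m).
Proof.
move=> mY; apply: (@adapted_measurable _ _ _ Y mY m).
by apply: adapted_runmax => i; exact: adapted_psum.
Qed.

(** With [t = s / b^2] the constraint [t * 2b <= 1/2] reads [s <= b / 4], and [m <= 2 b^4] turns the
    exponent [2 t^2 v m] into at most [4 v s^2], free of the scale. *)
Lemma runmax_subgaussian (Y : nat -> T -> R) m (b v : R) :
  1 <= b -> 1 <= v -> m%:R <= 2 * b ^+ 4 ->
  (forall p, measurable_fun setT (Y p)) -> seq_indep P Y m ->
  (forall p, \int[P]_w Y p w = 0) -> (forall p w, `|Y p w| <= 2 * b) ->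
  (forall p, \int[P]_w (Y p w ^+ 2) <= v) ->
  forall s, 0 <= s -> s <= b / 4 ->
  itg P (fun w => expR (s * (runmax (psum Y ^~ w) m / b ^+ 2))) /\
  \int[P]_w expR (s * (runmax (psum Y ^~ w) m / b ^+ 2)) <= 4 * expR (4 * v * s ^+ 2).
Proof.
move=> b1 v1 mb mY ind EY Yb Yv s s0 sb.
have b0 : 0 < b by lra.
have b20 : 0 < b ^+ 2 by rewrite exprn_gt0.
have t0 : 0 <= s / b ^+ 2 by rewrite divr_ge0// ltW.
have tb : s / b ^+ 2 * (2 * b) <= 2^-1.
  rewrite (_ : _ * _ = 2 * s / b); last by field; rewrite gt_eqF.
  by rewrite ler_pdivrMr//; lra.
have [i e] := psum_max_mgf mY ind EY Yb Yv t0 tb.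
rewrite (_ : (fun w => _) = fun w => expR (s / b ^+ 2 * runmax (psum Y ^~ w) m)).
  split => //; apply: (le_trans e); rewrite ler_pM2l// ler_expR.
  have vs : 0 <= 2 * v * s ^+ 2 / b ^+ 4.
    apply: divr_ge0; last by rewrite ltW// exprn_gt0.
    by apply: mulr_ge0 (sqr_ge0 _); lra.
  rewrite (_ : 2 * _ * v * _ = 2 * v * s ^+ 2 / b ^+ 4 * m%:R); last first.
    by field; rewrite gt_eqF.
  rewrite (_ : 4 * v * s ^+ 2 = 2 * v * s ^+ 2 / b ^+ 4 * (2 * b ^+ 4)); last first.
    by field; rewrite gt_eqF.
  exact: ler_wpM2l.
by apply/funext => w; congr expR; ring.
Qed.

Variables (X : nat -> T -> R) (m : nat) (b v g : R).
Hypotheses (b1 : 1 <= b) (v1 : 1 <= v) (mb : m%:R <= 2 * b ^+ 4).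
Hypothesis mX : forall p, measurable_fun setT (X p).
Hypothesis ind : seq_indep P X m.
Hypothesis iX : forall p, itg P (X p).
Hypothesis EX : forall p, \int[P]_w X p w = 0.
Hypothesis iX2 : forall p, itg P (fun w => X p w ^+ 2).
Hypothesis Xv : forall p, \int[P]_w (X p w ^+ 2) <= v.

Definition trunc (x : R) := if `|x| <= b then x else 0.
Definition tail (x : R) := if `|x| <= b then 0 else x.

Hypothesis Xg : forall p, \int[P]_w (tail (X p w) ^+ 2) <= g.

Let mtrunc : measurable_fun setT trunc.
Proof.
apply: measurable_fun_ifT => //.
by apply: measurable_fun_ler => //; exact: normr_measurable.
Qed.

Let mtail : measurable_fun setT tail.
Proof.
apply: measurable_fun_ifT => //.
by apply: measurable_fun_ler => //; exact: normr_measurable.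
Qed.

Let itrunc p : itg P (fun w => trunc (X p w)).
Proof.
apply: (itg_le _ (integrable_norm (iX p))); first exact: measurableT_comp.
by move=> w; rewrite /= /trunc; case: ifP => //; rewrite normr0.
Qed.

Let itail p : itg P (fun w => tail (X p w)).
Proof.
apply: (itg_le _ (integrable_norm (iX p))); first exact: measurableT_comp.
by move=> w; rewrite /= /tail; case: ifP => //; rewrite normr0.
Qed.

Let itrunc2 p : itg P (fun w => trunc (X p w) ^+ 2).
Proof.
apply: (itg_le _ (iX2 p)); first by apply: measurable_funX; exact: measurableT_comp.
move=> w; rewrite ger0_norm ?sqr_ge0// /trunc; case: ifP => // _.
by rewrite expr0n sqr_ge0.
Qed.

Let itail2 p : itg P (fun w => tail (X p w) ^+ 2).
Proof.
apply: (itg_le _ (iX2 p)); first by apply: measurable_funX; exact: measurableT_comp.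
move=> w; rewrite ger0_norm ?sqr_ge0// /tail; case: ifP => // _.
by rewrite expr0n sqr_ge0.
Qed.

(** [A] collects the truncated part, which has exponential moments, and [B] the tail part, for which
    only second moments are at hand. Both are normalised by [b^4], which is the length of the sums
    up to a factor 2. *)
Lemma level_bound : exists A B : T -> R,
  [/\ (forall w, 0 <= A w) /\ (forall w, 0 <= B w),
      (forall q w, (q <= m)%N -> psum X q w ^+ 2 <= b ^+ 4 * (A w + B w)),
      itg P B /\ \int[P]_w B w <= 32 * g,
      measurable_fun setT A /\
        (itg P (fun w => A w ^+ 2) /\ \int[P]_w (A w ^+ 2) <= 16 * mom4 v) &
      forall l, 2^-1 <= l ->
        itg P (fun w => Num.max (A w - 4 * (22 * v) ^+ 2 * l) 0) /\
        \int[P]_w Num.max (A w - 4 * (22 * v) ^+ 2 * l) 0 <=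
          64 * expR (- l) + 4 * (256 * mom4 v / b ^+ 2)].
Proof.
have b0 : 0 < b by have h := b1; lra.
have b20 : 0 < b ^+ 2 by rewrite exprn_gt0.
have b40 : 0 < b ^+ 4 by rewrite exprn_gt0.
pose c p := \int[P]_w trunc (X p w); pose c' p := \int[P]_w tail (X p w).
(* As [X p] is centred, centring the two parts separately leaves their sum unchanged. *)
have cc p : c p + c' p = 0.
  rewrite /c /c' -(ExD (itrunc p) (itail p)) -(EX p); congr Rintegral.
  by apply/funext => w; rewrite /trunc /tail; case: ifP => _; rewrite ?addr0 ?add0r.
pose Y p := (fun x => trunc x - c p) \o X p.
(* [runmax] is one-sided, so absolute values of sums are controlled by also running the negated
   sequences. *)
pose Y' p := (fun x => - (trunc x - c p)) \o X p.
pose Z p := (fun x => tail x - c' p) \o X p.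
pose Z' p := (fun x => - (tail x - c' p)) \o X p.
have mh p : measurable_fun setT (fun x => trunc x - c p) by exact: measurable_funB.
have mk p : measurable_fun setT (fun x => tail x - c' p) by exact: measurable_funB.
have mh' p : measurable_fun setT (fun x => - (trunc x - c p)) by exact: measurable_funN.
have mk' p : measurable_fun setT (fun x => - (tail x - c' p)) by exact: measurable_funN.
have mY p : measurable_fun setT (Y p) by exact: measurableT_comp.
have mY' p : measurable_fun setT (Y' p) by exact: measurableT_comp.
have mZ p : measurable_fun setT (Z p) by exact: measurableT_comp.
have mZ' p : measurable_fun setT (Z' p) by exact: measurableT_comp.
have iY p : itg P (Y p) by apply: itgB => //; exact: itg_cst.
have iZ p : itg P (Z p) by apply: itgB => //; exact: itg_cst.
have EY p : \int[P]_w Y p w = 0 by rewrite ExB ?Ex_cst ?subrr//; exact: itg_cst.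
have EZ p : \int[P]_w Z p w = 0 by rewrite ExB ?Ex_cst ?subrr//; exact: itg_cst.
have nE F : (fun w : T => - F w) = (fun w => -1 * F w) :> (T -> R).
  by apply/funext => w; rewrite mulN1r.
have iZ' p : itg P (Z' p).
  by rewrite [Z' p](_ : _ = fun w => - Z p w)// nE; exact: itgZ.
have EY' p : \int[P]_w Y' p w = 0.
  rewrite (_ : (fun w => Y' p w) = fun w => - Y p w)// nE.
  by rewrite (ExZ _ (iY p)) EY mulr0.
have EZ' p : \int[P]_w Z' p w = 0.
  rewrite (_ : (fun w => Z' p w) = fun w => - Z p w)// nE.
  by rewrite (ExZ _ (iZ p)) EZ mulr0.
have [iY2 Yv'] : (forall p, itg P (fun w => Y p w ^+ 2)) /\
    (forall p, \int[P]_w (Y p w ^+ 2) <= v).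
  split => p; have [i e] := sq_centered_le (itrunc p) (itrunc2 p); first exact: i.
  apply: (le_trans e); apply: le_trans (Xv p); apply: Ex_le => // w.
  by rewrite /trunc; case: ifP => // _; rewrite expr0n sqr_ge0.
have [iZ2 Zg] : (forall p, itg P (fun w => Z p w ^+ 2)) /\
    (forall p, \int[P]_w (Z p w ^+ 2) <= g).
  split => p; have [i e] := sq_centered_le (itail p) (itail2 p); first exact: i.
  exact: le_trans e (Xg p).
have sqN (U : T -> R) : (fun w => (- U w) ^+ 2) = (fun w => U w ^+ 2).
  by apply/funext => w; rewrite sqrrN.
have Yv'' p : \int[P]_w (Y' p w ^+ 2) <= v.
  by rewrite (_ : (fun w => Y' p w ^+ 2) = fun w => (- Y p w) ^+ 2)// sqN.
have iZ2' p : itg P (fun w => Z' p w ^+ 2).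
  by rewrite (_ : (fun w => Z' p w ^+ 2) = fun w => (- Z p w) ^+ 2)// sqN.
have Zg' p : \int[P]_w (Z' p w ^+ 2) <= g.
  by rewrite (_ : (fun w => Z' p w ^+ 2) = fun w => (- Z p w) ^+ 2)// sqN.
have tb x : `|trunc x| <= b.
  by rewrite /trunc; case: ifP => // _; rewrite normr0 ltW.
have cb p : `|c p| <= b.
  have tlb w := tb (X p w); rewrite ler_norml; apply/andP; split.
    rewrite -[leLHS](Ex_cst P); apply: Ex_le => [||w]; [exact: itg_cst|exact: itrunc|].
    by have := tlb w; rewrite ler_norml => /andP[].
  rewrite -[leRHS](Ex_cst P); apply: Ex_le => [||w]; [exact: itrunc|exact: itg_cst|].
  by have := tlb w; rewrite ler_norml => /andP[].
have Yb p w : `|Y p w| <= 2 * b.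
  rewrite /Y/= (le_trans (ler_normB _ _))//.
  by have := tb (X p w); have := cb p; lra.
have Yb' p w : `|Y' p w| <= 2 * b by rewrite /Y'/= normrN; exact: Yb.
have sY := seq_indep_comp mh ind; have sY' := seq_indep_comp mh' ind.
have sZ := seq_indep_comp mk ind; have sZ' := seq_indep_comp mk' ind.
pose V w := runmax (psum Y ^~ w) m / b ^+ 2.
pose V' w := runmax (psum Y' ^~ w) m / b ^+ 2.
have V0 w : 0 <= V w by rewrite divr_ge0 ?runmax_psum_ge0// ltW.
have V0' w : 0 <= V' w by rewrite divr_ge0 ?runmax_psum_ge0// ltW.
have mV : measurable_fun setT V.
  by apply: measurable_funM => //; exact: measurable_runmax_psum.
have mV' : measurable_fun setT V'.
  by apply: measurable_funM => //; exact: measurable_runmax_psum.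
have gV := runmax_subgaussian b1 v1 mb mY sY EY Yb Yv'.
have gV' := runmax_subgaussian b1 v1 mb mY' sY' EY' Yb' Yv''.
have [i4 e4] := subgaussian_mom4 b1 mV V0 gV.
have [i4' e4'] := subgaussian_mom4 b1 mV' V0' gV'.
have [iM eM] := psum_max_sq mZ sZ iZ EZ iZ2.
have [iM' eM'] := psum_max_sq mZ' sZ' iZ' EZ' iZ2'.
(* The factor 2 in [A] and [B] is that of [(y + z)^2 <= 2 y^2 + 2 z^2]. *)
pose A w := 2 * (V w ^+ 2 + V' w ^+ 2).
pose B w := 2 / b ^+ 4 * (runmax (psum Z ^~ w) m ^+ 2 + runmax (psum Z' ^~ w) m ^+ 2).
have pN (U : nat -> T -> R) (U' : nat -> T -> R) q w :
    (forall p, U' p w = - U p w) -> psum U' q w = - psum U q w.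
  by move=> UU; rewrite /psum -sumrN; apply: eq_bigr.
have sqle (x y z : R) : x <= y -> - x <= z -> 0 <= y -> 0 <= z -> x ^+ 2 <= y ^+ 2 + z ^+ 2.
  move=> xy xz y0 z0; have [x0|x0] := leP 0 x; nra.
exists A, B; split.
- split=> w; first by rewrite /A mulr_ge0// addr_ge0 ?sqr_ge0.
  by rewrite /B mulr_ge0 ?divr_ge0 ?addr_ge0 ?sqr_ge0// ltW.
- move=> q w qm.
  have e1 : psum X q w = psum Y q w + psum Z q w.
    rewrite /psum -big_split/=; apply: eq_bigr => p _.
    rewrite /Y /Z/= addrACA -opprD cc subr0 /trunc /tail.
    by case: ifP => _; rewrite ?addr0 ?add0r.
  have h1 : psum Y q w ^+ 2 <= b ^+ 4 * (V w ^+ 2 + V' w ^+ 2).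
    rewrite /V /V' (_ : _ * _ = runmax (psum Y ^~ w) m ^+ 2 + runmax (psum Y' ^~ w) m ^+ 2).
      apply: sqle; rewrite ?runmax_psum_ge0//; first exact: (@le_runmax _ (psum Y ^~ w)).
      by rewrite -(pN Y Y')//; exact: (@le_runmax _ (psum Y' ^~ w)).
    by field; rewrite gt_eqF.
  have h2 : psum Z q w ^+ 2 <= runmax (psum Z ^~ w) m ^+ 2 + runmax (psum Z' ^~ w) m ^+ 2.
    apply: sqle; rewrite ?runmax_psum_ge0//; first exact: (@le_runmax _ (psum Z ^~ w)).
    by rewrite -(pN Z Z')//; exact: (@le_runmax _ (psum Z' ^~ w)).
  rewrite e1 /A /B (_ : b ^+ 4 * (_ + _) = 2 * (b ^+ 4 * (V w ^+ 2 + V' w ^+ 2)) +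
    2 * (runmax (psum Z ^~ w) m ^+ 2 + runmax (psum Z' ^~ w) m ^+ 2)); last first.
    by field; rewrite gt_eqF.
  have := sqr_ge0 (psum Y q w - psum Z q w); nra.
- have iS := itgD iM iM'; split; first exact: itgZ.
  rewrite (ExZ _ iS) (ExD iM iM').
  have sg (U : nat -> T -> R) : (forall p, \int[P]_w (U p w ^+ 2) <= g) ->
      \sum_(p < m) \int[P]_w (U p w ^+ 2) <= m%:R * g.
    move=> H; rewrite mulr_natl -[X in g *+ X]card_ord -sumr_const.
    by apply: ler_sum => p _.
  have g0 : 0 <= g.
    by apply: le_trans (Zg 0%N); apply: Rintegral_ge0 => w _; exact: sqr_ge0.
  have h1 := sg _ Zg; have h2 := sg _ Zg'.
  have h3 : m%:R * g <= 2 * b ^+ 4 * g by rewrite ler_wpM2r.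
  rewrite mulrAC ler_pdivrMr//; lra.
- split; first by apply: measurable_funM => //; apply: measurable_funD; exact: measurable_funX.
  have iS := itgZ 8 (itgD i4 i4').
  have mA : measurable_fun setT (fun w => A w ^+ 2).
    by apply: measurable_funX; apply: measurable_funM => //; apply: measurable_funD; exact: measurable_funX.
  have le w : A w ^+ 2 <= 8 * (V w ^+ 4 + V' w ^+ 4).
    rewrite /A; have := sqr_ge0 (V w ^+ 2 - V' w ^+ 2); nra.
  have iA : itg P (fun w => A w ^+ 2).
    by apply: (itg_le mA iS) => w; rewrite ger0_norm ?sqr_ge0.
  split => //; apply: (le_trans (Ex_le iA iS le)).
  rewrite (ExZ _ (itgD i4 i4')) (ExD i4 i4').
  by move: e4 e4'; move: (mom4 v) (\int[P]_w (V w ^+ 4)) (\int[P]_w (V' w ^+ 4)) => a b' c0; lra.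
- move=> l l2.
  have [iE eE] := subgaussian_excess b1 v1 mV V0 gV l2.
  have [iE' eE'] := subgaussian_excess b1 v1 mV' V0' gV' l2.
  have iS := itgZ 2 (itgD iE iE').
  have mA : measurable_fun setT (fun w => Num.max (A w - 4 * (22 * v) ^+ 2 * l) 0).
    apply: measurable_maxr => //; apply: measurable_funB => //.
    by apply: measurable_funM => //; apply: measurable_funD; exact: measurable_funX.
  have le w : Num.max (A w - 4 * (22 * v) ^+ 2 * l) 0 <=
      2 * (Num.max (V w ^+ 2 - (22 * v) ^+ 2 * l) 0 + Num.max (V' w ^+ 2 - (22 * v) ^+ 2 * l) 0).
    rewrite /A; move: ((22 * v) ^+ 2) (V w ^+ 2) (V' w ^+ 2) => k x y.
    have h1 : x - k * l <= Num.max (x - k * l) 0 by rewrite le_max lexx.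
    have h2 : y - k * l <= Num.max (y - k * l) 0 by rewrite le_max lexx.
    have h3 : 0 <= Num.max (x - k * l) 0 by rewrite le_max lexx orbT.
    have h4 : 0 <= Num.max (y - k * l) 0 by rewrite le_max lexx orbT.
    by rewrite ge_max; apply/andP; split; lra.
  have iA : itg P (fun w => Num.max (A w - 4 * (22 * v) ^+ 2 * l) 0).
    by apply: (itg_le mA iS) => w; rewrite ger0_norm// le_max lexx orbT.
  split => //; apply: (le_trans (Ex_le iA iS le)).
  rewrite (ExZ _ (itgD iE iE')) (ExD iE iE').
  move: eE eE'; move: (expR _) (256 * _ / _) => e f.
  by move: (\int[P]_w _) (\int[P]_w _) => a b'; lra.
Qed.

End level.

(** * Monotone vectors against partial sums *)

Section dyadic.
Context {R : realType}.
Implicit Types v x : nat -> R.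

Lemma abel_sum v x N :
  \sum_(0 <= p < N) v p * x p =
  \sum_(0 <= p < N) (v p - v p.+1) * (\sum_(0 <= i < p.+1) x i) +
  v N * \sum_(0 <= i < N) x i.
Proof.
elim: N => [|N IH]; first by rewrite !big_geq// mulr0 addr0.
rewrite big_nat_recr//= IH [in RHS]big_nat_recr//=.
by rewrite big_nat_recr//=; ring.
Qed.

Lemma leq_pred_exp2 r : ((2 ^ r).-1 <= (2 ^ r.+1).-1)%N.
Proof. by rewrite -!subn1 leq_sub2r// leq_exp2l. Qed.

(** In Abel's formula index [p] goes with the partial sum of length [p.+1]. The predecessors make
    shell [r] collect the lengths from [2^r] up to, not including, [2^(r+1)]. *)
Lemma sum_dyadic (f : nat -> R) rho :
  \sum_(0 <= p < (2 ^ rho).-1) f p =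
  \sum_(0 <= r < rho) \sum_((2 ^ r).-1 <= p < (2 ^ r.+1).-1) f p.
Proof.
elim: rho => [|rho IH]; first by rewrite !big_geq.
rewrite [in RHS]big_nat_recr//= -IH -big_cat_nat//=.
exact: leq_pred_exp2.
Qed.

(** The value at [2^(k+1) - 1] is at most each of the [2^k] values with index from [2^k] on, so
    weight [2^(k+1)] is covered by twice that stretch of the sum. *)
Lemma sum_dyadic_sq v rho : (forall p, 0 <= v p) -> (forall p, v p.+1 <= v p) ->
  \sum_(0 <= r < rho) 2 ^+ r * v (2 ^ r).-1 ^+ 2 <=
  2 * \sum_(0 <= p < 2 ^ rho) v p ^+ 2.
Proof.
move=> v0 vd.
have vm p q : (p <= q)%N -> v q <= v p.
  move=> pq; rewrite -(subnKC pq); elim: (q - p)%N => [|k IH]; first by rewrite addn0.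
  by rewrite addnS (le_trans (vd _)).
suff H k : \sum_(0 <= r < k.+1) 2 ^+ r * v (2 ^ r).-1 ^+ 2 <=
    2 * \sum_(0 <= p < 2 ^ k) v p ^+ 2.
  case: rho => [|rho].
    by rewrite big_geq// mulr_ge0// sumr_ge0// => p _; exact: sqr_ge0.
  apply: (le_trans (H rho)); rewrite ler_pM2l//.
  rewrite [leRHS](@big_cat_nat _ _ _ (2 ^ rho)%N)//=; last by rewrite leq_exp2l.
  by rewrite lerDl sumr_ge0// => p _; exact: sqr_ge0.
elim: k => [|k IH].
  by rewrite !big_nat1 expr0 mul1r /=; have := sqr_ge0 (v 0); lra.
rewrite big_nat_recr//= [X in _ <= 2 * X](@big_cat_nat _ _ _ (2 ^ k)%N)//=; last by rewrite leq_exp2l.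
rewrite mulrDr lerD// exprS -mulrA ler_pM2l//.
have -> : 2 ^+ k * v (2 ^ k.+1).-1 ^+ 2 = \sum_(2 ^ k <= p < 2 ^ k.+1) v (2 ^ k.+1).-1 ^+ 2.
  rewrite big_const_nat iter_addr_0 (_ : (2 ^ k.+1 - 2 ^ k)%N = (2 ^ k)%N).
    by rewrite -[RHS]mulr_natl natrX.
  by rewrite expnS; lia.
apply: ler_sum_nat => p /andP[p1 p2]; rewrite lerXn2r ?nnegrE//; apply: vm.
by rewrite -ltnS prednK// expn_gt0.
Qed.

(** Within a shell the drops of [v] add up to at most its first value, so a shell costs that value
    times the largest partial sum. A shell with a jump can charge [u] to that jump; a shell without
    one contributes nothing. *)
Lemma monotone_dyadic_bound v x (m rho : nat) (eta : nat -> R) (u : R) :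
  (forall p, 0 <= v p) -> (forall p, v p.+1 <= v p) ->
  (forall p, (m <= p)%N -> v p = 0) -> (m < 2 ^ rho)%N ->
  (forall r, 0 <= eta r) -> 0 <= u ->
  (forall r q, (r < rho)%N -> (q <= m)%N -> (q < 2 ^ r.+1)%N ->
     (\sum_(0 <= p < q) x p) ^+ 2 <= 2 ^+ r * eta r) ->
  2 * \sum_(0 <= p < m) v p * x p <=
  4^-1 * \sum_(0 <= p < m) v p ^+ 2 +
  8 * (u * \sum_(0 <= p < m) (v p != v p.+1)%:R +
       \sum_(0 <= r < rho) Num.max (eta r - u) 0).
Proof.
move=> v0 vd vm mrho eta0 u0 Hx.
have ext (f : nat -> R) N : (m <= N)%N -> (forall p, (m <= p)%N -> f p = 0) ->
    \sum_(0 <= p < m) f p = \sum_(0 <= p < N) f p.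
  move=> mN f0; rewrite [RHS](@big_cat_nat _ _ _ m)//=.
  rewrite (_ : \sum_(m <= i < N) f i = 0) ?addr0// big_nat_cond big1// => p.
  by move=> /andP[/andP[mp _] _]; exact: f0.
have mN : (m <= (2 ^ rho).-1)%N by lia.
rewrite (ext (fun p => v p * x p) _ mN); last by move=> p mp; rewrite vm// mul0r.
rewrite (ext (fun p => (v p != v p.+1)%:R) _ mN); last first.
  by move=> p mp; rewrite !vm ?eqxx// ltnW.
rewrite (ext (fun p => v p ^+ 2) (2 ^ rho)%N); [|exact: ltnW|]; last first.
  by move=> p mp; rewrite vm// expr0n.
rewrite abel_sum (vm _ mN) mul0r addr0 !sum_dyadic.
have sq := sum_dyadic_sq rho v0 vd.
have key r : (r < rho)%N ->
  2 * \sum_((2 ^ r).-1 <= p < (2 ^ r.+1).-1) (v p - v p.+1) * (\sum_(0 <= i < p.+1) x i)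
  <= 8^-1 * (2 ^+ r * v (2 ^ r).-1 ^+ 2) +
  8 * (u * \sum_((2 ^ r).-1 <= p < (2 ^ r.+1).-1) (v p != v p.+1)%:R +
       Num.max (eta r - u) 0).
  move=> rr; set J := \sum_(_ <= p < _) (v p != v p.+1)%:R.
  have h2r : 0 < 2 ^+ r :> R by rewrite exprn_gt0.
  have mx0 : 0 <= Num.max (eta r - u) 0 by rewrite le_max lexx orbT.
  have mx1 : eta r - u <= Num.max (eta r - u) 0 by rewrite le_max lexx.
  have J0 : 0 <= J by apply: sumr_ge0 => p _; exact: ler0n.
  have w0 : 0 <= 2 ^+ r * v (2 ^ r).-1 ^+ 2 by rewrite mulr_ge0 ?sqr_ge0// ltW.
  have [/existsP[p pj]|] := boolP [exists p : 'I_(2 ^ r.+1).-1, ((2 ^ r).-1 <= p)%N && (v p != v p.+1)].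
    have J1 : 1 <= J.
      rewrite /J (@big_cat_nat _ _ _ p)//=; [|by case/andP: pj|exact: ltnW].
      rewrite [X in _ + X]big_ltn//; case/andP: pj => _ ->.
      by rewrite addrCA lerDl addr_ge0// sumr_ge0// => i _; exact: ler0n.
    pose H := Num.sqrt (2 ^+ r * eta r).
    have H0 : 0 <= H by exact: sqrtr_ge0.
    have HH : H ^+ 2 = 2 ^+ r * eta r by rewrite sqr_sqrtr// mulr_ge0// ltW.
    have le1 : \sum_((2 ^ r).-1 <= p < (2 ^ r.+1).-1) (v p - v p.+1) * (\sum_(0 <= i < p.+1) x i)
        <= \sum_((2 ^ r).-1 <= p < (2 ^ r.+1).-1) (v p - v p.+1) * H.
      apply: ler_sum_nat => q /andP[q1 q2].
      have [mq|qm] := leqP m q; first by rewrite !vm ?subrr ?mul0r// ltnW.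
      apply: ler_wpM2l; first by rewrite subr_ge0.
      apply: (le_trans (ler_norm _)); rewrite -(ger0_norm H0) -ler_sqr ?nnegrE//.
      by rewrite -!normrX !ger0_norm ?sqr_ge0// HH Hx// -ltn_predRL.
    have le2 : \sum_((2 ^ r).-1 <= p < (2 ^ r.+1).-1) (v p - v p.+1) * H <= v (2 ^ r).-1 * H.
      rewrite -mulr_suml ler_wpM2r//.
      under eq_bigr do rewrite -opprB.
      rewrite sumrN telescope_sumr; last exact: leq_pred_exp2.
      by rewrite opprB gerBl.
    (* The weight 1/8 becomes 1/4 after [sum_dyadic_sq], small enough to be absorbed into the risk
       at the end. *)
    have le3 : 2 * (v (2 ^ r).-1 * H) <= 8^-1 * (2 ^+ r * v (2 ^ r).-1 ^+ 2) + 8 * eta r.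
      rewrite -(@ler_pM2l _ (2 ^+ r)) //.
      have := sqr_ge0 (2 ^+ r * v (2 ^ r).-1 - 8 * H).
      rewrite sqrrB exprMn [(8 * H) ^+ 2]exprMn HH.
      move: (2 ^+ r) (v (2 ^ r).-1) (eta r) => a b c; lra.
    have : u <= u * J by rewrite ler_peMr.
    lra.
  rewrite negb_exists => /forallP nj.
  rewrite big_nat_cond big1 ?mulr0; last first.
    move=> p /andP[/andP[p1 p2] _]; have := nj (Ordinal p2); rewrite /= p1/= negbK.
    by move=> /eqP <-; rewrite subrr mul0r.
  by rewrite addr_ge0 ?mulr_ge0// addr_ge0// mulr_ge0.
rewrite mulr_sumr.
apply: (@le_trans _ _ (\sum_(0 <= r < rho) (8^-1 * (2 ^+ r * v (2 ^ r).-1 ^+ 2) +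
  8 * (u * \sum_((2 ^ r).-1 <= p < (2 ^ r.+1).-1) (v p != v p.+1)%:R +
       Num.max (eta r - u) 0)))).
  by apply: ler_sum_nat => r /andP[_ rr]; exact: key.
rewrite big_split/= -!mulr_sumr big_split/= -mulr_sumr lerD2r.
lra.
Qed.

End dyadic.

(** * Reduction of a monotone fit to monotone pieces on the oracle blocks *)

Section blocks.
Context {R : realType}.

Lemma sum_nat_rev (f : nat -> R) m :
  \sum_(0 <= p < m) f p = \sum_(0 <= p < m) f (m - p.+1)%N.
Proof. by rewrite big_nat_rev; apply: eq_bigr. Qed.

Lemma sum_last_le1 m : \sum_(0 <= p < m) (p.+1 == m)%:R <= 1 :> R.
Proof.
case: m => [|m]; first by rewrite big_geq.
rewrite big_nat_recr//= eqxx big_nat_cond big1 ?add0r// => p /andP[/andP[_ pm] _].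
by rewrite eqSS ltn_eqF.
Qed.

(** The guard restricts jumps to neighbours inside the window, so a change across its right end is
    not counted. *)
Definition jump (U : nat -> R) m p := ((p.+1 < m)%N && (U p != U p.+1)).

Lemma sum_jump_rev (U : nat -> R) m :
  \sum_(0 <= p < m) ((p.+1 < m)%N && (U (m - p.+1)%N != U (m - p.+2)%N))%:R =
  \sum_(0 <= p < m) (jump U m p)%:R :> R.
Proof.
pose g i : R := ((0 < i)%N && (U i != U i.-1))%:R.
transitivity (\sum_(0 <= p < m) g (m - p.+1)%N).
  apply: eq_big_nat => p /andP[_ pm]; rewrite /g -subnS; congr (_ && _)%:R.
  by rewrite subn_gt0.
rewrite -sum_nat_rev; case: m => [|m]; first by rewrite !big_geq.
rewrite big_nat_recl// [in RHS]big_nat_recr//= /g/= /jump ltnn/= add0r addr0.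
by apply: eq_big_nat => p /andP[_ pm]; rewrite ltnS pm/= eq_sym.
Qed.

(** For nondecreasing [U] the negative part is nonincreasing from the left end and the positive part
    is nonincreasing from the right end. Hence partial sums from both ends are needed, [el] for the
    left and [er] for the right. *)
Lemma one_block_bound (U x : nat -> R) (m rho : nat) (el er : nat -> R) (u : R) :
  (forall p, (p.+1 < m)%N -> U p <= U p.+1) -> (m < 2 ^ rho)%N ->
  (forall r, 0 <= el r) -> (forall r, 0 <= er r) -> 0 <= u ->
  (forall r q, (r < rho)%N -> (q <= m)%N -> (q < 2 ^ r.+1)%N ->
     (\sum_(0 <= p < q) x p) ^+ 2 <= 2 ^+ r * el r) ->
  (forall r q, (r < rho)%N -> (q <= m)%N -> (q < 2 ^ r.+1)%N ->
     (\sum_(0 <= p < q) x (m - p.+1)%N) ^+ 2 <= 2 ^+ r * er r) ->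
  2 * \sum_(0 <= p < m) U p * x p <=
  4^-1 * \sum_(0 <= p < m) U p ^+ 2 +
  8 * (2 * u * (1 + \sum_(0 <= p < m) (jump U m p)%:R) +
       \sum_(0 <= r < rho) (Num.max (el r - u) 0 + Num.max (er r - u) 0)).
Proof.
move=> Um mrho el0 er0 u0 Hl Hr.
pose pos (y : R) := Num.max y 0.
have pos0 y : 0 <= pos y by rewrite /pos le_max lexx orbT.
have poshomo y y' : y <= y' -> pos y <= pos y'.
  by move=> yy; rewrite /pos ge_max !le_max yy lexx orbT.
pose vl p := if (p < m)%N then pos (- U p) else 0.
pose vr p := if (p < m)%N then pos (U (m - p.+1)%N) else 0.
have Br : 2 * \sum_(0 <= p < m) vr p * x (m - p.+1)%N <=
  4^-1 * \sum_(0 <= p < m) vr p ^+ 2 + 8 * (u * \sum_(0 <= p < m) (vr p != vr p.+1)%:R +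
     \sum_(0 <= r < rho) Num.max (er r - u) 0).
  apply: (@monotone_dyadic_bound _ vr (fun p => x (m - p.+1)%N)) => // p.
  - by rewrite /vr; case: ifP.
  - rewrite /vr; case: (ltnP p.+1 m) => pm; last by case: ifP.
    rewrite (ltnW pm); apply: poshomo.
    rewrite (_ : m - p.+1 = (m - p.+2).+1)%N; last by lia.
    by apply: Um; lia.
  - by rewrite /vr ltnNge => ->.
have Bl : 2 * \sum_(0 <= p < m) vl p * - x p <=
  4^-1 * \sum_(0 <= p < m) vl p ^+ 2 + 8 * (u * \sum_(0 <= p < m) (vl p != vl p.+1)%:R +
     \sum_(0 <= r < rho) Num.max (el r - u) 0).
  apply: (@monotone_dyadic_bound _ vl (fun p => - x p)) => // [p|p|p|r q rr qm q2].
  - by rewrite /vl; case: ifP.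
  - rewrite /vl; case: (ltnP p.+1 m) => pm; last by case: ifP.
    by rewrite (ltnW pm); apply: poshomo; rewrite lerN2; exact: Um.
  - by rewrite /vl ltnNge => ->.
  - by rewrite sumrN sqrrN; exact: Hl.
set J := \sum_(0 <= p < m) (jump U m p)%:R.
(* The extra 1 pays for the drop to the default value 0 at the end of the block. *)
have Jl : \sum_(0 <= p < m) (vl p != vl p.+1)%:R <= 1 + J :> R.
  apply: (@le_trans _ _ (\sum_(0 <= p < m) ((p.+1 == m)%:R + (jump U m p)%:R))).
    apply: ler_sum_nat => p /andP[_ pm]; rewrite -natrD ler_nat /jump /vl pm.
    case: (ltngtP p.+1 m) => //= pm'; [|lia|by rewrite leq_b1].
    by case: (eqVneq (U p) (U p.+1)) => [->|_]; rewrite ?eqxx// leq_b1.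
  by rewrite big_split/= lerD2r sum_last_le1.
have Jr : \sum_(0 <= p < m) (vr p != vr p.+1)%:R <= 1 + J :> R.
  rewrite /J -sum_jump_rev.
  apply: (@le_trans _ _ (\sum_(0 <= p < m) ((p.+1 == m)%:R +
     ((p.+1 < m)%N && (U (m - p.+1)%N != U (m - p.+2)%N))%:R))).
    apply: ler_sum_nat => p /andP[_ pm]; rewrite -natrD ler_nat /vr pm.
    case: (ltngtP p.+1 m) => //= pm'; [|lia|by rewrite leq_b1].
    by case: (eqVneq (U (m - p.+1)%N) (U (m - p.+2)%N)) => [->|_]; rewrite ?eqxx// leq_b1.
  by rewrite big_split/= lerD2r sum_last_le1.
have E1 : \sum_(0 <= p < m) U p * x p =
    \sum_(0 <= p < m) vl p * - x p + \sum_(0 <= p < m) vr p * x (m - p.+1)%N.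
  rewrite [X in _ = _ + X]sum_nat_rev -big_split/=.
  apply: eq_big_nat => p /andP[_ pm]; rewrite /vl /vr pm.
  have -> : (m - p.+1 < m)%N by lia.
  have -> : (m - (m - p.+1).+1)%N = p by lia.
  rewrite /pos; case: (leP (U p) 0) => h.
    by rewrite max_l ?oppr_ge0// mul0r addr0 mulrNN.
  by rewrite max_r ?oppr_le0 ?ltW// mul0r add0r.
have E2 : \sum_(0 <= p < m) U p ^+ 2 =
    \sum_(0 <= p < m) vl p ^+ 2 + \sum_(0 <= p < m) vr p ^+ 2.
  rewrite [X in _ = _ + X]sum_nat_rev -big_split/=.
  apply: eq_big_nat => p /andP[_ pm]; rewrite /vl /vr pm.
  have -> : (m - p.+1 < m)%N by lia.
  have -> : (m - (m - p.+1).+1)%N = p by lia.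
  rewrite /pos; case: (leP (U p) 0) => h.
    by rewrite max_l ?oppr_ge0// expr0n addr0 sqrrN.
  by rewrite max_r ?oppr_le0 ?ltW// expr0n add0r.
rewrite E1 E2 big_split/=.
have h1 : u * \sum_(0 <= p < m) (vl p != vl p.+1)%:R <= u * (1 + J) by exact: ler_wpM2l.
have h2 : u * \sum_(0 <= p < m) (vr p != vr p.+1)%:R <= u * (1 + J) by exact: ler_wpM2l.
lra.
Qed.

Lemma sum_blocks (f : nat -> R) (a : nat -> nat) k : a 0%N = 0%N ->
  (forall j, (j < k)%N -> (a j <= a j.+1)%N) ->
  \sum_(0 <= i < a k) f i =
  \sum_(0 <= j < k) \sum_(0 <= p < a j.+1 - a j) f (a j + p)%N.
Proof.
move=> a0; elim: k => [|k IH] am; first by rewrite a0 !big_geq.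
have amk := am k (ltnSn k).
have amj j : (j < k)%N -> (a j <= a j.+1)%N by move=> jk; exact: am (ltnW _).
rewrite [in RHS]big_nat_recr//= -IH// (@big_cat_nat _ _ _ (a k))//=; congr (_ + _).
rewrite -{1}[a k]add0n big_addn; apply: eq_bigr => p _.
by rewrite addnC.
Qed.

Lemma all_blocks_bound (n k kh : nat) (a : nat -> nat) (t th z mu : nat -> R)
    (rho : nat -> nat) (el er : nat -> nat -> R) (u : R) :
  a 0%N = 0%N -> a k = n -> (forall j, (j < k)%N -> (a j <= a j.+1)%N) ->
  (forall j i, (j < k)%N -> (a j <= i < a j.+1)%N -> th i = mu j) ->
  (forall i, (i.+1 < n)%N -> t i <= t i.+1) ->
  \sum_(0 <= i < n) (jump t n i)%:R <= kh%:R :> R ->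
  (forall j, (j < k)%N -> (a j.+1 - a j < 2 ^ rho j)%N) ->
  (forall j r, 0 <= el j r) -> (forall j r, 0 <= er j r) -> 0 <= u ->
  (forall j r q, (j < k)%N -> (r < rho j)%N -> (q <= a j.+1 - a j)%N -> (q < 2 ^ r.+1)%N ->
     (\sum_(0 <= p < q) z (a j + p)%N) ^+ 2 <= 2 ^+ r * el j r) ->
  (forall j r q, (j < k)%N -> (r < rho j)%N -> (q <= a j.+1 - a j)%N -> (q < 2 ^ r.+1)%N ->
     (\sum_(0 <= p < q) z (a j + (a j.+1 - a j - p.+1))%N) ^+ 2 <= 2 ^+ r * er j r) ->
  2 * \sum_(0 <= i < n) (t i - th i) * z i <=
  4^-1 * \sum_(0 <= i < n) (t i - th i) ^+ 2 +
  8 * (2 * u * (k%:R + kh%:R) + \sum_(0 <= j < k) \sum_(0 <= r < rho j)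
         (Num.max (el j r - u) 0 + Num.max (er j r - u) 0)).
Proof.
move=> a0 ak am thmu tm tj arho el0 er0 u0 Hl Hr.
have aj j : (j < k)%N -> (a j.+1 <= n)%N.
  move=> jk; rewrite -ak -(subnKC jk).
  have : (j.+1 + (k - j.+1) <= k)%N by lia.
  elim: (k - j.+1)%N => [|i IH] ik; first by rewrite addn0.
  by rewrite addnS (leq_trans (IH _))// ?am//; lia.
pose U j p := t (a j + p)%N - mu j.
have E1 : \sum_(0 <= i < n) (t i - th i) * z i =
    \sum_(0 <= j < k) \sum_(0 <= p < a j.+1 - a j) U j p * z (a j + p)%N.
  rewrite -ak sum_blocks//; apply: eq_big_nat => j /andP[_ jk].
  by apply: eq_big_nat => p /andP[_ pm]; rewrite (thmu j)//; lia.
have E2 : \sum_(0 <= i < n) (t i - th i) ^+ 2 =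
    \sum_(0 <= j < k) \sum_(0 <= p < a j.+1 - a j) U j p ^+ 2.
  rewrite -ak sum_blocks//; apply: eq_big_nat => j /andP[_ jk].
  by apply: eq_big_nat => p /andP[_ pm]; rewrite (thmu j)//; lia.
(* Subtracting [mu j] creates no jump inside block [j], so all blocks together see at most the jumps
   of [t]. *)
have E3 : \sum_(0 <= j < k) \sum_(0 <= p < a j.+1 - a j)
    (jump (U j) (a j.+1 - a j) p)%:R <= kh%:R :> R.
  apply: le_trans tj.
  have -> : \sum_(0 <= i < n) (jump t n i)%:R = \sum_(0 <= i < a k) (jump t n i)%:R :> R.
    by rewrite ak.
  rewrite (sum_blocks _ a0 am); apply: ler_sum_nat => j /andP[_ jk].
  apply: ler_sum_nat => p /andP[_ pm]; rewrite ler_nat /jump /U addnS.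
  case: (ltnP p.+1 _) => // pm'; have := aj _ jk => ajn.
  have -> : ((a j + p).+1 < n)%N by lia.
  by rewrite (inj_eq (addIr _)) .
have key j : (0 <= j < k)%N -> 2 * \sum_(0 <= p < a j.+1 - a j) U j p * z (a j + p)%N <=
  4^-1 * \sum_(0 <= p < a j.+1 - a j) U j p ^+ 2 +
  8 * (2 * u * (1 + \sum_(0 <= p < a j.+1 - a j) (jump (U j) (a j.+1 - a j) p)%:R) +
       \sum_(0 <= r < rho j) (Num.max (el j r - u) 0 + Num.max (er j r - u) 0)).
  move=> /andP[_ jk].
  apply: one_block_bound => //; [|exact: arho| |].
  - move=> p pm; rewrite /U lerD2r addnS; apply: tm; have := aj _ jk; lia.
  - by move=> r q; exact: Hl.
  - by move=> r q; exact: Hr.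
rewrite E1 E2 mulr_sumr.
apply: (le_trans (ler_sum_nat key)).
rewrite big_split/= -!mulr_sumr big_split/= -mulr_sumr big_split/=.
rewrite lerD2l ler_pM2l// lerD2r ler_wpM2l ?mulr_ge0//.
rewrite lerD//.
by rewrite big_const_nat iter_addr_0 subn0.
Qed.

End blocks.

(** * Tail sums under condition (M) *)

Section tails.
Context {R : realType}.

(* [beta ^+ r] is the truncation level [2 ^ (r / 4)] of the dyadic scale [r]. *)
Definition beta : R := Num.sqrt (Num.sqrt 2).

Lemma beta_pow4 : beta ^+ 4 = 2.
Proof. by rewrite (exprM beta 2 2) !sqr_sqrtr// sqrtr_ge0. Qed.

Lemma beta_gt1 : 1 < beta.
Proof. by rewrite -[ltLHS]sqrtr1 ltr_sqrt// -[ltLHS]sqrtr1 ltr_sqrt ?ltr1n. Qed.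

Lemma beta_gt0 : 0 < beta. Proof. exact: lt_trans beta_gt1. Qed.

Lemma betaX_ge1 r : 1 <= beta ^+ r.
Proof. by rewrite exprn_ege1// ltW// beta_gt1. Qed.

Lemma geometric_sum_le (q : R) n : 0 <= q < 1 ->
  \sum_(0 <= r < n) q ^+ r <= (1 - q)^-1.
Proof.
move=> /andP[q0 q1]; have q1' : 0 < 1 - q by rewrite subr_gt0.
rewrite -[leRHS]mul1r ler_pdivlMr//.
suff -> : (\sum_(0 <= r < n) q ^+ r) * (1 - q) = 1 - q ^+ n.
  by rewrite gerBl exprn_ge0.
elim: n => [|n IH]; first by rewrite big_geq// mul0r expr0 subrr.
by rewrite big_nat_recr//= mulrDl IH exprS; ring.
Qed.

Lemma tail_sq_le_powR (B x e : R) : 1 <= B -> 0 < e ->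
  tail B x ^+ 2 <= B `^ (- e) * `|x| `^ (2 + e).
Proof.
move=> B1 e0; have B0 : 0 < B by lra.
rewrite /tail; case: (leP `|x| B) => [_|xB].
  by rewrite expr0n/= mulr_ge0 ?powR_ge0.
have x0 : 0 < `|x| by lra.
have -> : `|x| `^ (2 + e) = x ^+ 2 * `|x| `^ e.
  rewrite powRD; last by apply/implyP => _; rewrite gt_eqF.
  by rewrite (@powR_mulrn _ _ 2) ?normr_ge0// -normrX ger0_norm ?sqr_ge0.
rewrite mulrCA ler_peMr ?sqr_ge0// powRN mulrC ler_pdivlMr ?powR_gt0// mul1r.
by apply: ge0_ler_powR; rewrite ?nnegrE ltW.
Qed.

Lemma sq_le_powR (x e : R) : 0 < e -> x ^+ 2 <= 1 + `|x| `^ (2 + e).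
Proof.
move=> e0; have [x1|x1] := leP `|x| 1.
  rewrite -[x ^+ 2]ger0_norm ?sqr_ge0// normrX.
  by rewrite (le_trans (exprn_ile1 _ (normr_ge0 x) x1))// lerDl powR_ge0.
have := @tail_sq_le_powR 1 x e (lexx 1) e0; rewrite powR1 mul1r /tail [`|x| <= 1]leNgt x1/=.
by move=> h; rewrite (le_trans h)// lerDr.
Qed.

Lemma ln_expR1D_ge1 (x : R) : 0 <= x -> 1 <= ln (expR 1 + x).
Proof.
move=> x0; rewrite -[leLHS](@expRK R) ler_ln ?posrE ?expR_gt0 ?lerDl//.
by rewrite ltr_wpDr// expR_gt0.
Qed.

(** The levels below [|x|] number about [ln |x| / ln beta]. This is what the logarithm in the second
    moment condition pays for. *)
Lemma count_levels (x : R) n :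
  \sum_(0 <= r < n) ((beta ^+ r < `|x|)%R)%:R <=
  (1 + (2 * ln beta)^-1) * ln (expR 1 + x ^+ 2).
Proof.
have lb : 0 < ln beta by rewrite ln_gt0// beta_gt1.
have L1 := ln_expR1D_ge1 (sqr_ge0 x).
have c0 : 0 <= (2 * ln beta)^-1 by rewrite invr_ge0 mulr_ge0// ltW.
elim: n => [|n IH]; first by rewrite big_geq// mulr_ge0// ?addr_ge0//; lra.
rewrite big_nat_recr//=; case: (ltP (beta ^+ n) `|x|) => [h|_]; last by rewrite addr0.
apply: (@le_trans _ _ (n%:R + 1)).
  rewrite lerD2r -[leRHS](_ : \sum_(0 <= r < n) 1 = n%:R); last first.
    by rewrite big_const_nat iter_addr_0 subn0.
  by apply: ler_sum => r _; case: (_ < _).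
rewrite mulrDl mul1r addrC lerD// -(@ler_pM2l _ (2 * ln beta)) ?mulr_gt0//.
rewrite mulVKf ?gt_eqF ?mulr_gt0//.
have -> : 2 * ln beta * n%:R = ln ((beta ^+ n) ^+ 2).
  by rewrite lnXn ?exprn_gt0 ?beta_gt0// lnXn ?beta_gt0//; ring.
rewrite ler_ln ?posrE ?exprn_gt0 ?beta_gt0//; last first.
  by rewrite ltr_wpDr ?sqr_ge0 ?expR_gt0.
apply: (@le_trans _ _ (x ^+ 2)); last by rewrite lerDr expR_ge0.
rewrite -[leRHS]ger0_norm ?sqr_ge0// normrX lerXn2r ?nnegrE ?exprn_ge0//.
  by rewrite ltW// beta_gt0.
exact: ltW.
Qed.

Lemma sum_tail_sq_le (x : R) n :
  \sum_(0 <= r < n) tail (beta ^+ r) x ^+ 2 <=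
  (1 + (2 * ln beta)^-1) * (x ^+ 2 * ln (expR 1 + x ^+ 2)).
Proof.
rewrite mulrCA (le_trans _ (ler_wpM2l (sqr_ge0 x) (count_levels x n)))// mulr_sumr.
apply: ler_sum => r _; rewrite /tail [`|x| <= _]leNgt.
by case: (_ < _); rewrite /= ?mulr1// expr0n mulr0.
Qed.

Lemma measurable_tail (B : R) : measurable_fun setT (tail B).
Proof.
apply: measurable_fun_ifT => //.
by apply: measurable_fun_ler => //; exact: normr_measurable.
Qed.

Lemma tail_sq_le (B x : R) : tail B x ^+ 2 <= x ^+ 2.
Proof. by rewrite /tail; case: ifP => // _; rewrite expr0n sqr_ge0. Qed.

Context d (T : measurableType d) (P : probability T R).

Lemma eq_dist_integral (X Y : T -> R) (f : R -> R) :
  measurable_fun setT X -> measurable_fun setT Y -> measurable_fun setT f ->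
  (forall x, 0 <= f x) ->
  (forall B, measurable B -> P (X @^-1` B) = P (Y @^-1` B)) ->
  (\int[P]_w (f (X w))%:E = \int[P]_w (f (Y w))%:E)%E.
Proof.
move=> mX mY mf f0 XY.
pose X' : {mfun T >-> R} := HB.pack X (isMeasurableFun.Build _ _ _ _ _ mX).
pose Y' : {mfun T >-> R} := HB.pack Y (isMeasurableFun.Build _ _ _ _ _ mY).
have mEf : measurable_fun setT (EFin \o f) by exact/measurable_EFinP.
have ef (V : {mfun T >-> R}) :
    (\int[P]_w (f (V w))%:E = \int[distribution P V]_x (f x)%:E)%E.
  rewrite /distribution (@ge0_integral_pushforward _ _ _ _ _ _ _ _ _ (EFin \o f))//.
  by move=> y _; rewrite /= lee_fin.
rewrite (ef X') (ef Y'); apply: eq_measure_integral => A mA _.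
exact: XY.
Qed.

End tails.

(** Under the first alternative the tails decay geometrically with ratio [beta^(- eps)]. The second
    gives no rate at a single scale, so there the sum over scales is taken before the expectation.
    [K] adds the bounds of both cases and is fixed before [n] and the law. *)
Lemma condM_tails (R : realType) (eps C1 : R) : 0 < eps -> 0 < C1 ->
  exists2 K : R, 0 <= K &
  forall (n : nat) d (T : measurableType d) (P : probability T R)
    (Z : 'I_n -> T -> R) (sigma : R),
    (0 < n)%N -> 0 < sigma -> condM P Z sigma eps C1 ->
  exists g : nat -> R,
  [/\ (forall i, itg P (fun w => (Z i w / sigma) ^+ 2)),
      (forall i, \int[P]_w ((Z i w / sigma) ^+ 2) <= 1 + K),
      (forall i r, \int[P]_w (tail (beta ^+ r) (Z i w / sigma) ^+ 2) <= g r) &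
      (forall n, \sum_(0 <= r < n) g r <= K)].
Proof.
move=> e0 C0.
pose q : R := beta `^ (- eps).
have q0 : 0 < q by rewrite powR_gt0// beta_gt0.
have q1 : q < 1.
  rewrite /q powRN invf_lt1 ?powR_gt0 ?beta_gt0//.
  rewrite -[ltLHS](_ : 1 `^ eps = 1); last by rewrite powR1.
  by rewrite gt0_ltr_powR// ?nnegrE ?beta_gt1// ltW// beta_gt0.
have lb : 0 < ln (beta : R) by rewrite ln_gt0// beta_gt1.
pose c2 : R := 1 + (2 * ln beta)^-1.
have c20 : 0 <= c2 by rewrite addr_ge0// invr_ge0 mulr_ge0// ltW.
have q1' : 0 < 1 - q by rewrite subr_gt0.
have K1 : 0 <= C1 / (1 - q) by rewrite divr_ge0// ltW.
have K2 : 0 <= c2 * C1 by rewrite mulr_ge0// ltW.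
exists (C1 / (1 - q) + c2 * C1); first exact: addr_ge0.
move=> n d T P Z sigma n0 s0 [mZ _ _ Hm].
pose U i w := Z i w / sigma.
have mU i : measurable_fun setT (U i) by apply: measurable_funM => //; exact: measurable_cst.
have mU2 i : measurable_fun setT (fun w => U i w ^+ 2) by exact: measurable_funX.
have mt i r : measurable_fun setT (fun w => tail (beta ^+ r) (U i w) ^+ 2).
  by apply: measurable_funX; apply: measurableT_comp => //; exact: measurable_tail.
have Ile (f : T -> R) : measurable_fun setT f -> (forall w, 0 <= f w) ->
    (\int[P]_w (f w)%:E <= C1%:E)%E -> itg P f /\ \int[P]_w f w <= C1.
  move=> mf f0 lef; have iF : itg P f.
    apply: itgP => //; under eq_integral do rewrite ger0_norm//.
    exact: le_lt_trans lef (ltry _).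
  by split => //; rewrite -lee_fin -itg_integral.
suff [g [H1 H2 H3]] : exists g : nat -> R,
  [/\ (forall i, itg P (fun w => U i w ^+ 2)),
      (forall i r, \int[P]_w (tail (beta ^+ r) (U i w) ^+ 2) <= g r) &
      (forall n, \sum_(0 <= r < n) g r <= C1 / (1 - q) + c2 * C1)].
  exists g; split => // i.
  (* Level [beta ^+ 0 = 1] also bounds the second moment: [x^2 <= 1 + tail 1 x ^ 2]. *)
  have it : itg P (fun w => tail (beta ^+ 0) (U i w) ^+ 2).
    by apply: (itg_le (mt i 0) (H1 i)) => w; rewrite ger0_norm ?sqr_ge0// tail_sq_le.
  have iD := itgD (itg_cst P 1) it.
  apply: (le_trans (Ex_le (H1 i) iD _)).
    move=> w; rewrite /tail expr0; case: (leP `|U i w| 1) => h; last by rewrite lerDr.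
    rewrite expr0n addr0 -[leLHS]ger0_norm ?sqr_ge0// normrX.
    exact: exprn_ile1.
  rewrite (ExD (itg_cst P 1) it) Ex_cst lerD2l (le_trans (H2 i 0))//.
  by have := H3 1%N; rewrite big_nat1.
case: Hm => [H|[same H]].
- have mf i : measurable_fun setT (fun w => `|U i w| `^ (2 + eps)).
    apply: (measurableT_comp (measurable_powR (2 + eps))).
    exact: measurableT_comp.
  have Hi i := Ile _ (mf i) (fun w => powR_ge0 _ _) (H i).
  have i2 i : itg P (fun w => U i w ^+ 2).
    have [iF _] := Hi i; apply: (itg_le (mU2 i) (itgD (itg_cst P 1) iF)) => w.
    by rewrite ger0_norm ?sqr_ge0// sq_le_powR.
  exists (fun r => q ^+ r * C1); split => // [i r|m].
    have [iF eF] := Hi i.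
    have it : itg P (fun w => tail (beta ^+ r) (U i w) ^+ 2).
      by apply: (itg_le (mt i r) (i2 i)) => w; rewrite ger0_norm ?sqr_ge0// tail_sq_le.
    have qr : (beta ^+ r) `^ (- eps) = q ^+ r.
      rewrite -(powR_mulrn _ (ltW beta_gt0)) -(powR_mulrn _ (ltW q0)) /q.
      by rewrite -!powRrM mulrC.
    apply: (le_trans (Ex_le it (itgZ (q ^+ r) iF) _)).
      by move=> w; rewrite -qr; apply: tail_sq_le_powR => //; exact: betaX_ge1.
    by rewrite (ExZ _ iF) ler_wpM2l// exprn_ge0// ltW.
  rewrite -mulr_suml mulrC; apply: (@le_trans _ _ (C1 / (1 - q))); last by rewrite lerDl.
  by apply: ler_wpM2l; [exact: ltW|apply: geometric_sum_le; rewrite q1 ltW].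
- have lge i w : 1 <= ln (expR 1 + U i w ^+ 2) by exact: ln_expR1D_ge1 (sqr_ge0 _).
  have mf i : measurable_fun setT (fun w => U i w ^+ 2 * ln (expR 1 + U i w ^+ 2)).
    apply: measurable_funM => //; apply: (measurableT_comp (@measurable_ln R)).
    by apply: measurable_funD => //; exact: measurable_cst.
  have Hi i : itg P (fun w => U i w ^+ 2 * ln (expR 1 + U i w ^+ 2)) /\
     \int[P]_w (U i w ^+ 2 * ln (expR 1 + U i w ^+ 2)) <= C1.
    apply: Ile (mf i) _ (H i) => w; rewrite mulr_ge0 ?sqr_ge0//.
    exact: le_trans ler01 (lge i w).
  have i2 i : itg P (fun w => U i w ^+ 2).
    have [iF _] := Hi i; apply: (itg_le (mU2 i) iF) => w.
    by rewrite ger0_norm ?sqr_ge0// ler_peMr ?sqr_ge0.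
  have it i r : itg P (fun w => tail (beta ^+ r) (U i w) ^+ 2).
    by apply: (itg_le (mt i r) (i2 i)) => w; rewrite ger0_norm ?sqr_ge0// tail_sq_le.
  (* Without identical distributions the scales could see different worst indices,
     and the suprema over the indices need not be summable. *)
  pose i0 : 'I_n := Ordinal n0.
  exists (fun r => \int[P]_w (tail (beta ^+ r) (U i0 w) ^+ 2)); split => // [i r|m].
    rewrite -lee_fin -!itg_integral//.
    rewrite (@eq_dist_integral _ _ _ P (Z i) (Z i0) (fun x => tail (beta ^+ r) (x / sigma) ^+ 2))//.
    - apply: measurable_funX; apply: measurableT_comp; first exact: measurable_tail.
      exact: mulrr_measurable.
    - by move=> x; exact: sqr_ge0.
    - by move=> B mB; exact: same.
  have Es k : itg P (fun w => \sum_(0 <= r < k) tail (beta ^+ r) (U i0 w) ^+ 2) /\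
    \int[P]_w (\sum_(0 <= r < k) tail (beta ^+ r) (U i0 w) ^+ 2) =
    \sum_(0 <= r < k) \int[P]_w (tail (beta ^+ r) (U i0 w) ^+ 2).
    elim: k => [|k [IH1 IH2]].
      under [X in itg P X]funext do rewrite big_geq//.
      under [X in Rintegral _ _ X]funext do rewrite big_geq//.
      by split; [exact: itg_cst|rewrite Ex_cst big_geq].
    under [X in itg P X]funext do rewrite big_nat_recr//=.
    under [X in Rintegral _ _ X]funext do rewrite big_nat_recr//=.
    by split; [exact: itgD|rewrite (ExD IH1 (it i0 k)) IH2 big_nat_recr].
  have [iS <-] := Es m; have [iF eF] := Hi i0.
  apply: (le_trans (Ex_le iS (itgZ c2 iF) _)).
    by move=> w; exact: sum_tail_sq_le.
  by rewrite (ExZ _ iF) -[leLHS]add0r lerD// ler_wpM2l.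
Qed.

(** * Piecewise constant vectors and the penalty *)

Section pieces.
Context {R : realType}.

Lemma chain_leq (a : nat -> nat) k i j :
  (forall j, (j < k)%N -> (a j <= a j.+1)%N) -> (i <= j <= k)%N -> (a i <= a j)%N.
Proof.
move=> am /andP[ij jk]; rewrite -(subnKC ij).
have : (i + (j - i) <= k)%N by lia.
elim: (j - i)%N => [|l IH] il; first by rewrite addn0.
by rewrite addnS (leq_trans (IH _))// ?am//; lia.
Qed.

(** Shifting [mu] numbers the pieces from 0, and [inord] lets vectors be read as functions on [nat],
    as the block lemmas require. *)
Lemma ThetaUpP n k (th : 'I_n.+1 -> R) : ThetaUp k th ->
  exists (a : nat -> nat) (mu : nat -> R),
  [/\ a 0%N = 0%N, a k = n.+1, (forall j, (j < k)%N -> (a j <= a j.+1)%N),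
      (forall j j', (j <= j' < k)%N -> mu j <= mu j') &
      (forall j i, (j < k)%N -> (a j <= i < a j.+1)%N -> th (inord i) = mu j)].
Proof.
move=> [a [mu [a0 ak am mm H]]]; exists a, (fun j => mu j.+1); split => //.
- move=> j j' /andP[jj jk]; rewrite -(subnKC jj).
  have : (j + (j' - j) < k)%N by lia.
  elim: (j' - j)%N => [|l IH] il; first by rewrite addn0.
  by rewrite addnS (le_trans (IH _))//; [lia|apply: mm; lia].
- move=> j i jk /andP[i1 i2]; apply: H => //=.
  have i3 : (i < n.+1)%N.
    by rewrite -ak; apply: (leq_trans i2); apply: chain_leq am _; lia.
  by rewrite inordK// ltnS i1.
Qed.

Lemma find_piece (a : nat -> nat) k i : a 0%N = 0%N -> (i < a k)%N ->
  exists2 j, (j < k)%N & (a j <= i < a j.+1)%N.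
Proof.
move=> a0 ik; have ex : exists j, (i < a j)%N by exists k.
case: (ex_minnP ex) => -[|j] ij jmin; first by rewrite a0 in ij.
exists j; first exact: jmin.
rewrite ij andbT leqNgt; apply/negP => /jmin; by rewrite ltnn.
Qed.

Lemma ThetaUp_nondecreasing n k (th : 'I_n.+1 -> R) i : ThetaUp k th ->
  (i.+1 < n.+1)%N -> th (inord i) <= th (inord i.+1).
Proof.
move=> /ThetaUpP[a [mu [a0 ak am mm H]]] i1.
have [j jk ij] : exists2 j, (j < k)%N & (a j <= i < a j.+1)%N.
  by apply: find_piece => //; rewrite ak ltnW.
have [j' jk' ij'] : exists2 j, (j < k)%N & (a j <= i.+1 < a j.+1)%N.
  by apply: find_piece => //; rewrite ak.
rewrite (H _ _ jk ij) (H _ _ jk' ij'); apply: mm; rewrite jk' andbT leqNgt.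
apply/negP => jj; have := @chain_leq a k j'.+1 j am; lia.
Qed.

(** A jump occurs only at a breakpoint [a j.+1], and each breakpoint accounts for at most one index;
    the double sum counts these incidences in both orders. *)
Lemma ThetaUp_jumps n k (th : 'I_n.+1 -> R) : ThetaUp k th ->
  \sum_(0 <= i < n.+1) (jump (fun i => th (inord i)) n.+1 i)%:R <= k%:R :> R.
Proof.
move=> /ThetaUpP[a [mu [a0 ak am mm H]]].
apply: (@le_trans _ _ (\sum_(0 <= i < n.+1) \sum_(0 <= j < k) (a j.+1 == i.+1)%:R)).
  apply: ler_sum_nat => i /andP[_ i1]; rewrite /jump.
  case: (ltnP i.+1 n.+1) => //= i2; last by apply: sumr_ge0 => j _; exact: ler0n.
  have [j jk ij] : exists2 j, (j < k)%N & (a j <= i < a j.+1)%N.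
    by apply: find_piece => //; rewrite ak.
  have [e|e] := eqVneq (a j.+1) i.+1.
    rewrite (@big_cat_nat _ _ _ j)//=; last exact: ltnW.
    rewrite [X in _ + X]big_ltn// e eqxx addrCA.
    apply: (@le_trans _ _ 1); first by case: (_ != _); rewrite ?lexx ?ler01.
    by rewrite lerDl addr_ge0// sumr_ge0// => l _; exact: ler0n.
  rewrite (H _ _ jk ij) (H j i.+1 jk) ?eqxx; last by move: ij e; lia.
  by apply: sumr_ge0 => l _; exact: ler0n.
rewrite exchange_big/= -[leRHS](_ : \sum_(0 <= j < k) 1 = k%:R); last first.
  by rewrite big_const_nat iter_addr_0 subn0.
apply: ler_sum => j _; case: (a j.+1) => [|l].
  by rewrite big1.
have [ln|nl] := leqP n.+1 l.
  rewrite big_nat_cond big1// => i /andP[/andP[_ i1] _].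
  by rewrite eqSS gtn_eqF// (leq_trans i1).
rewrite (@big_cat_nat _ _ _ l)//=; last exact: ltnW.
rewrite [X in _ + X]big_ltn// eqxx.
rewrite big_nat_cond big1; last by move=> i /andP[/andP[_ i1] _]; rewrite eqSS gtn_eqF.
rewrite big_nat_cond big1 ?addr0 ?add0r// => i /andP[/andP[i1 _] _].
by rewrite eqSS ltn_eqF.
Qed.

End pieces.

Section subsequences.
Context d (T : measurableType d) (R : realType) (P : probability T R).

Lemma seq_indep_sub n (Z : 'I_n -> T -> R) (e : nat -> 'I_n) (X : nat -> T -> R) m
    (s : R) :
  (forall i, measurable_fun setT (Z i)) -> mutually_independent P Z ->
  {in gtn m &, injective e} ->
  (forall p, (p < m)%N -> X p = fun w => Z (e p) w / s) ->
  seq_indep P X m.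
Proof.
move=> mZ ind inj XE k km B mB.
pose f (x : R) := x / s.
have mf : measurable_fun setT f by exact: mulrr_measurable.
have mfB p : measurable (f @^-1` B p) by rewrite -[X in measurable X]setTI; exact: mf.
pose e' (p : 'I_k) := e p.
have inj' : injective e'.
  move=> p q epq; apply/val_inj/inj => //.
    by rewrite inE /= (leq_trans (ltn_ord p)).
  by rewrite inE /= (leq_trans (ltn_ord q)).
(* Coordinates outside the range of [e'] get the sure event, which contributes a factor 1. *)
pose C i := if [pick p | e' p == i] is Some p then f @^-1` B p else setT.
have mC i : measurable (C i) by rewrite /C; case: pickP.
have Ce p : C (e' p) = f @^-1` B p.
  by rewrite /C; case: pickP => [q /eqP/inj' ->//|/(_ p)]; rewrite eqxx.
have -> : cylinder X k B = \bigcap_i (Z i @^-1` C i).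
  apply/seteqP; split => [w H i _|w H p pk].
    rewrite /= /C; case: pickP => // p /eqP <-; rewrite /= /f.
    have := H p (ltn_ord p); rewrite XE//.
    exact: leq_trans (ltn_ord p) km.
  have := H (e p) I; rewrite /= -[e p]/(e' (Ordinal pk)) Ce/= /f XE//.
  exact: leq_trans pk km.
rewrite ind// (bigID (fun i => i \in e' @: 'I_k))/=.
rewrite [X in (_ * X)%E]big1 ?mule1.
  rewrite big_imset/=; last by move=> p q _ _; exact: inj'.
  apply: eq_bigr => p _; rewrite Ce XE//; exact: leq_trans (ltn_ord p) km.
move=> i iN; rewrite /C; case: pickP => [p /eqP ei|_].
  by move: iN; rewrite -ei imset_f.
by rewrite preimage_setT probability_setT.
Qed.

End subsequences.

(** * Logarithms in the penalty and the number of scales *)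

Section penalty.
Context {R : realType}.

Lemma expR_half_le2 : expR 2^-1 <= 2 :> R.
Proof.
have h := expR_ge1Dx (- 2^-1 : R); have e0 := expR_gt0 (2^-1 : R).
have := expRxMexpNx_1 (2^-1 : R).
by move: (expR 2^-1) (expR (- 2^-1)) h e0 => x y; nra.
Qed.

Lemma ln2_ge : 2^-1 <= ln 2 :> R.
Proof. by rewrite -[leLHS](@expRK R) ler_ln ?posrE ?expR_gt0// expR_half_le2. Qed.

Lemma ln16_ge : 2 <= ln 16 :> R.
Proof.
rewrite (_ : 16 = 2 ^+ 4 :> R); last by rewrite -natrX.
by rewrite lnXn//; have := ln2_ge; lra.
Qed.

Lemma ln_le_subr1 (x : R) : 0 < x -> ln x <= x - 1.
Proof.
move=> x0; have := @le_ln1Dx R (x - 1); rewrite addrCA subrr addr0; apply; lra.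
Qed.

Lemma sqr_le_expR_half (x : R) : 0 <= x -> x ^+ 2 <= 8 * expR (x / 2).
Proof.
move=> x0; have h0 : 0 <= x / 2 by rewrite divr_ge0.
have := @expR_ge1Dxn R _ 1 h0; rewrite (_ : 2`!%:R = 2 :> R)// exprMn.
by move: (expR _) => E; rewrite exprVn; lra.
Qed.

Variables (n : nat).

(** The factor 16 keeps this logarithm at least 2, and hence the iterated one at least 1/2, even for
    [k = n]. *)
Definition Lk k : R := ln (16 * n%:R / k%:R).
Definition lam k : R := ln (Lk k).
Definition pk k : R := if k == 1%N then 1 else k%:R * lam k.

Lemma pen_pk tau k : pen tau n k = tau * pk k.
Proof. by rewrite /pen /pk; case: ifP => _; rewrite ?mulr1// mulrA. Qed.

Lemma Lk_ge k : (0 < k <= n)%N -> 1 + ln (n%:R / k%:R) <= Lk k /\ 2 <= Lk k.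
Proof.
move=> /andP[k0 kn].
have k0' : 0 < k%:R :> R by rewrite ltr0n.
have n0' : 0 < n%:R :> R by rewrite ltr0n (leq_trans k0).
have nk : 1 <= n%:R / k%:R :> R by rewrite ler_pdivlMr// mul1r ler_nat.
have E : Lk k = ln 16 + ln (n%:R / k%:R).
  by rewrite /Lk -mulrA lnM ?posrE ?divr_gt0.
have := ln_ge0 nk; have := ln16_ge; rewrite E; lra.
Qed.

Lemma expR_Lk k : (0 < k <= n)%N -> expR (Lk k) = 16 * n%:R / k%:R.
Proof.
move=> /andP[k0 kn]; rewrite lnK// posrE divr_gt0 ?ltr0n// mulr_gt0// ltr0n.
exact: leq_trans kn.
Qed.

Lemma lam_ge k : (0 < k <= n)%N -> 2^-1 <= lam k.
Proof.
move=> kn; have [_ L2] := Lk_ge kn; apply: (le_trans ln2_ge).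
by rewrite ler_ln// posrE; lra.
Qed.

Lemma expRN_lam k : (0 < k <= n)%N -> expR (- lam k) = (Lk k)^-1.
Proof.
by move=> kn; have [_ L2] := Lk_ge kn; rewrite expRN lnK// posrE; lra.
Qed.

Lemma pk_ge k : (0 < k <= n)%N -> k%:R <= 2 * pk k.
Proof.
move=> kn; have := lam_ge kn; rewrite /pk; case: eqP => [->|_] h; first by lra.
have : 0 <= k%:R :> R by []; nra.
Qed.

Lemma pk_ge0 k : (0 < k <= n)%N -> 0 <= pk k.
Proof. by move=> /pk_ge; have : 0 <= k%:R :> R by []; lra. Qed.

(** If [kh] is at most [k * sqrt (16 n / k)], its logarithm is at least half that of [k], so the
    iterated logarithms are comparable. If exactly one of the two equals 1, the other penalty pays
    for both; with [k = kh = 1] nothing pays for [lam 1]. *)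
Lemma lam_le_pk k kh : (0 < k <= n)%N -> (0 < kh <= n)%N ->
  ~~ ((k == 1%N) && (kh == 1%N)) -> kh%:R <= k%:R * expR (Lk k / 2) ->
  lam k * (k%:R + kh%:R) <= 8 * (pk k + pk kh).
Proof.
move=> kn khn n1 khk.
have [k0 k1] := andP kn; have [kh0 kh1] := andP khn.
have k0' : 0 < k%:R :> R by rewrite ltr0n.
have kh0' : 0 < kh%:R :> R by rewrite ltr0n.
have [_ L2] := Lk_ge kn; have [_ Lh2] := Lk_ge khn.
have L0 : 0 < Lk k by lra.
have lh := lam_ge khn; have l0 := lam_ge kn.
have LL : Lk k / 2 <= Lk kh.
  rewrite -ler_expR (expR_Lk khn) ler_pdivlMr// mulrC.
  rewrite -(@ler_pM2l _ (k%:R)) // mulrA mulrAC.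
  have -> : k%:R * (16 * n%:R) = k%:R * (k%:R * (expR (Lk k / 2) * expR (Lk k / 2))) :> R.
    rewrite -expRD -splitr (expR_Lk kn); field.
    by rewrite gt_eqF.
  rewrite [leRHS]mulrA [leRHS]mulrA mulrAC -mulrA [leRHS]mulrAC.
  have E0 := expR_gt0 (Lk k / 2).
  by move: (expR _) E0 khk => E E0 khk; nra.
have ll : lam k <= 4 * lam kh.
  have : lam k - 1 <= lam kh.
    apply: (@le_trans _ _ (ln (Lk k / 2))); last by rewrite ler_ln ?posrE//; lra.
    rewrite ln_div ?posrE// lerD2l lerN2.
    by have := @ln_le_subr1 2; lra.
  lra.
have k1R : 1 <= k%:R :> R by rewrite ler1n.
have kh1R : 1 <= kh%:R :> R by rewrite ler1n.
have f1 : lam k * kh%:R <= 4 * (kh%:R * lam kh).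
  by rewrite [kh%:R * _]mulrC mulrA ler_wpM2r.
have f2 : lam k <= lam k * kh%:R by rewrite ler_peMr//; lra.
have f4 : lam k <= lam k * k%:R by rewrite ler_peMr//; lra.
have p0 : 0 <= kh%:R * lam kh by rewrite mulr_ge0//; lra.
move: n1 f1 f2 f4 p0; rewrite /pk mulrDr [k%:R * lam k]mulrC.
case: (eqVneq k 1%N) => [->|kN]; case: (eqVneq kh 1%N) => [->|khN] //= _ f1 f2 f4 p0;
  lra.
Qed.

(** Concavity of the logarithm, through its tangent at the mean block length [n / k]: the linear
    terms add up exactly because the lengths sum to [n]. *)
Lemma sum_levels_le k (a : nat -> nat) (rho : nat -> nat) : (0 < k <= n)%N ->
  a 0%N = 0%N -> a k = n -> (forall j, (j < k)%N -> (a j <= a j.+1)%N) ->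
  (forall j, rho j = if (a j.+1 - a j == 0)%N then 0%N
                     else (trunc_log 2 (a j.+1 - a j)).+1) ->
  \sum_(0 <= j < k) (rho j)%:R <= 2 * k%:R * Lk k.
Proof.
move=> kn a0 ak am rhoE.
have [k0 k1] := andP kn.
have k0' : 0 < k%:R :> R by rewrite ltr0n.
have n0' : 0 < n%:R :> R by rewrite ltr0n (leq_trans k0).
have nk : 1 <= n%:R / k%:R :> R by rewrite ler_pdivlMr// mul1r ler_nat.
have nk0 := ln_ge0 nk.
apply: (@le_trans _ _ (\sum_(0 <= j < k)
  (2 * (k%:R / n%:R) * (a j.+1 - a j)%:R + 2 * ln (n%:R / k%:R)))).
  apply: ler_sum_nat => j /andP[_ jk]; rewrite rhoE.
  case: eqVneq => [->|m0]; first by rewrite mulr0 add0r mulr_ge0.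
  set m := (a j.+1 - a j)%N in m0 *.
  have m0' : 0 < m%:R :> R by rewrite ltr0n lt0n.
  have h1 : (trunc_log 2 m)%:R <= 2 * ln m%:R :> R.
    have : ln (2 ^+ trunc_log 2 m) <= ln m%:R :> R.
      rewrite ler_ln ?posrE ?exprn_gt0// -natrX ler_nat.
      by apply: trunc_logP => //; rewrite lt0n.
    rewrite lnXn//; have : 2^-1 * (trunc_log 2 m)%:R <= ln 2 *+ trunc_log 2 m :> R.
      by rewrite -[leRHS]mulr_natr; apply: ler_wpM2r => //; exact: ln2_ge.
    lra.
  have x0 : 0 < k%:R / n%:R * m%:R :> R by rewrite mulr_gt0// divr_gt0.
  have := ln_le_subr1 x0; rewrite lnM ?posrE ?divr_gt0//.
  have -> : ln (k%:R / n%:R) = - ln (n%:R / k%:R) :> R.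
    by rewrite -lnV ?posrE ?divr_gt0// invf_div.
  rewrite -natr1; lra.
rewrite big_split/= -mulr_sumr.
have -> : \sum_(0 <= j < k) (a j.+1 - a j)%:R = n%:R :> R.
  have E : \sum_(0 <= j < k) (a j.+1 - a j)%:R = \sum_(0 <= j < k) ((a j.+1)%:R - (a j)%:R) :> R.
    by apply: eq_big_nat => j /andP[_ jk]; rewrite natrB// am.
  by rewrite E telescope_sumr// a0 ak subr0.
rewrite big_const_nat iter_addr_0 subn0.
have -> : 2 * (k%:R / n%:R) * n%:R = 2 * k%:R :> R by rewrite -mulrA divfK// gt_eqF.
have [h _] := Lk_ge kn.
rewrite (_ : _ + _ = 2 * (k%:R * (1 + ln (n%:R / k%:R)))).
  by rewrite -[leRHS]mulrA !ler_pM2l.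
by rewrite -[_ *+ k]mulr_natl; ring.
Qed.

End penalty.

(** * The noise term *)

Lemma max_addr_le (R : realType) (A B x : R) : 0 <= B ->
  Num.max (A + B - x) 0 <= Num.max (A - x) 0 + B.
Proof.
move=> B0; have h1 : 0 <= Num.max (A - x) 0 by rewrite le_max lexx orbT.
have h2 : A - x <= Num.max (A - x) 0 by rewrite le_max lexx.
by rewrite ge_max; apply/andP; split; lra.
Qed.

Section mean_bounds.
Context d (T : measurableType d) (R : realType) (P : probability T R).

Definition mean_le (f : T -> R) (c : R) := itg P f /\ \int[P]_w f w <= c.

Lemma mean_leD f g a b : mean_le f a -> mean_le g b ->
  mean_le (fun w => f w + g w) (a + b).
Proof. by move=> [i e] [i' e']; split; [exact: itgD|rewrite (ExD i i') lerD]. Qed.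

Lemma mean_leZ (c : R) f a : 0 <= c -> mean_le f a ->
  mean_le (fun w => c * f w) (c * a).
Proof. by move=> c0 [i e]; split; [exact: itgZ|rewrite (ExZ _ i) ler_wpM2l]. Qed.

Lemma mean_leW f a b : a <= b -> mean_le f a -> mean_le f b.
Proof. by move=> ab [i e]; split => //; exact: le_trans e ab. Qed.

Lemma mean_le_sum n (f : nat -> T -> R) (c : nat -> R) :
  (forall i, (i < n)%N -> mean_le (f i) (c i)) ->
  mean_le (fun w => \sum_(0 <= i < n) f i w) (\sum_(0 <= i < n) c i).
Proof.
elim: n => [|n IH] H.
  rewrite (_ : (fun w => _) = fun=> 0); last by apply/funext => w; rewrite big_geq.
  by rewrite big_geq//; split; [exact: itg_cst|rewrite Ex_cst].
rewrite (_ : (fun w => _) = fun w => \sum_(0 <= i < n) f i w + f n w); last first.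
  by apply/funext => w; rewrite big_nat_recr.
rewrite big_nat_recr//=; apply: mean_leD; last exact: H.
by apply: IH => i ni; apply: H; exact: ltnW.
Qed.

End mean_bounds.

Section block_levels.
Context d (T : measurableType d) (R : realType) (P : probability T R).

Definition level_data (v g : R) (r m : nat) (x : nat -> T -> R) (A B : T -> R) :=
  [/\ (forall w, 0 <= A w) /\ (forall w, 0 <= B w),
      (forall q w, (q <= m)%N -> (q < 2 ^ r.+1)%N ->
        (\sum_(0 <= p < q) x p w) ^+ 2 <= 2 ^+ r * (A w + B w)),
      mean_le P B (32 * g),
      mean_le P (fun w => A w ^+ 2) (16 * mom4 v) &
      forall l, 2^-1 <= l ->
        mean_le P (fun w => Num.max (A w - 4 * (22 * v) ^+ 2 * l) 0)
          (64 * expR (- l) + 4 * (256 * mom4 v / (beta ^+ r) ^+ 2))].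

Variables (n : nat) (Z : 'I_n -> T -> R) (s v : R) (g : nat -> R).
Hypotheses (v1 : 1 <= v).
Hypothesis mZ : forall i, measurable_fun setT (Z i).
Hypothesis ind : mutually_independent P Z.
Hypothesis iZ : forall i, itg P (fun w => Z i w / s).
Hypothesis EZ : forall i, \int[P]_w (Z i w / s) = 0.
Hypothesis iZ2 : forall i, itg P (fun w => (Z i w / s) ^+ 2).
Hypothesis Zv : forall i, \int[P]_w ((Z i w / s) ^+ 2) <= v.
Hypothesis Zg : forall i r, \int[P]_w (tail (beta ^+ r) (Z i w / s) ^+ 2) <= g r.

Lemma block_level (e : nat -> 'I_n) (m r : nat) : {in gtn m &, injective e} ->
  exists AB : (T -> R) * (T -> R),
    level_data v (g r) r m (fun p w => Z (e p) w / s) AB.1 AB.2.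
Proof.
move=> inj.
(* Scale [r] only concerns lengths below [2^(r+1)]; cutting there gives the length condition
   [m' <= 2 b^4] with [b = beta ^+ r]. *)
pose m' := minn m (2 ^ r.+1).-1.
have pw := expn_gt0 2 r.+1.
have m'm : (m' <= m)%N by exact: geq_minl.
have m'2 : (m' < 2 ^ r.+1)%N.
  by have := geq_minr m (2 ^ r.+1).-1; rewrite -/m'; move: pw; lia.
pose X p := if (p < m')%N then fun w => Z (e p) w / s else cst 0.
have v0 : 0 <= v by exact: le_trans ler01 v1.
have g0 : 0 <= g r.
  by apply: le_trans (Zg (e 0%N) r); apply: Rintegral_ge0 => w _; exact: sqr_ge0.
have mX p : measurable_fun setT (X p).
  rewrite /X; case: ifP => _; last exact: measurable_cst.
  by apply: measurable_funM => //; exact: measurable_cst.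
have sX : seq_indep P X m'.
  apply: (@seq_indep_sub _ _ _ _ n Z e X m' s) => //.
    by move=> p q; rewrite !inE => pm qm; apply: inj; rewrite inE (leq_trans _ m'm).
  by move=> p pm; rewrite /X pm.
have iX p : itg P (X p) by rewrite /X; case: ifP => _ //; exact: itg_cst.
have EX p : \int[P]_w X p w = 0 by rewrite /X; case: ifP => _ //; exact: Ex_cst.
have sq0 : (fun w : T => (cst 0 w : R) ^+ 2) = fun=> 0.
  by apply/funext => w; rewrite expr0n.
have iX2 p : itg P (fun w => X p w ^+ 2).
  by rewrite /X; case: ifP => _ //; rewrite sq0; exact: itg_cst.
have Xv p : \int[P]_w (X p w ^+ 2) <= v.
  by rewrite /X; case: ifP => _ //; rewrite sq0 Ex_cst.
have Xg p : \int[P]_w (tail (beta ^+ r) (X p w) ^+ 2) <= g r.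
  rewrite /X; case: ifP => _ //.
  rewrite (_ : (fun w => _) = fun=> 0) ?Ex_cst//.
  by apply/funext => w; rewrite /tail; case: ifP => _; rewrite expr0n.
have b4 : (beta ^+ r) ^+ 4 = 2 ^+ r :> R by rewrite exprAC beta_pow4.
have mb : m'%:R <= 2 * (beta ^+ r) ^+ 4 :> R.
  by rewrite b4 -exprS -natrX ler_nat ltnW.
have [A [B [AB0 S HB [_ HA] He]]] :=
  level_bound (betaX_ge1 r) v1 mb mX sX iX EX iX2 Xv Xg.
exists (A, B); split => //= q w qm q2.
have qm' : (q <= m')%N by rewrite leq_min qm/= -ltnS prednK.
have := S q w qm'; rewrite b4 /psum big_mkord.
rewrite (eq_bigr (fun p : 'I_q => Z (e p) w / s))// => p _.
by rewrite /X (leq_trans (ltn_ord p) qm').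
Qed.

Lemma sum_sq_mean (e : nat -> 'I_n) m : {in gtn m &, injective e} ->
  mean_le P (fun w => (\sum_(0 <= p < m) Z (e p) w / s) ^+ 2) (m%:R * v).
Proof.
move=> inj; pose X p := fun w => Z (e p) w / s.
have mX p : measurable_fun setT (X p).
  by apply: measurable_funM => //; exact: measurable_cst.
have sX : seq_indep P X m by exact: (@seq_indep_sub _ _ _ _ n Z e X m s).
have [i ee] := @psum_sq _ _ _ P X mX m sX (fun p => iZ (e p)) (fun p => EZ (e p))
   (fun p => iZ2 (e p)) m (leqnn m).
rewrite (_ : (fun w => _) = fun w => psum X m w ^+ 2); last first.
  by apply/funext => w; rewrite /psum big_mkord.
split => //; rewrite ee mulr_natl -[X in v *+ X]card_ord -sumr_const.
by apply: ler_sum => p _; exact: Zv.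
Qed.

End block_levels.

Lemma inord_injl n a b : (b <= n.+1)%N ->
  {in gtn (b - a)%N &, injective (fun p => inord (a + p)%N : 'I_n.+1)}.
Proof.
move=> bn p q; rewrite !inE => pm qm /(congr1 val) /=.
by rewrite !inordK; lia.
Qed.

Lemma inord_injr n a b : (b <= n.+1)%N ->
  {in gtn (b - a)%N &, injective (fun p => inord (a + (b - a - p.+1))%N : 'I_n.+1)}.
Proof.
move=> bn p q; rewrite !inE => pm qm /(congr1 val) /=.
by rewrite !inordK; lia.
Qed.

(** [Q] is chosen before [w], [kh] and [t], so the bound may be applied to any data-dependent
    fit. *)
Lemma noise_bound (R : realType) (eps C1 : R) : 0 < eps -> 0 < C1 ->
  exists C3 C4 : R, [/\ 0 < C3, 0 < C4 &
  forall (n : nat) d (T : measurableType d) (P : probability T R)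
    (Z : 'I_n.+1 -> T -> R) (s : R) (k : nat) (th : 'I_n.+1 -> R),
  0 < s -> condM P Z s eps C1 -> (0 < k <= n.+1)%N -> ThetaUp k th ->
  exists2 Q : T -> R, mean_le P Q (C4 * k%:R) &
  forall w (kh : nat) (t : 'I_n.+1 -> R), (0 < kh <= n.+1)%N -> ThetaUp kh t ->
  2 * \sum_i (t i - th i) * (Z i w / s) <=
  4^-1 * \sum_i (t i - th i) ^+ 2 + C3 * (pk n.+1 k + pk n.+1 kh) + Q w].
Proof.
move=> e0 C0; have [K K0 HK] := condM_tails e0 C0.
pose v := 1 + K; have v1 : 1 <= v by rewrite lerDl.
pose D := mom4 v; have D0 : 0 <= D by exact: mom4_ge0.
pose c := 4 * (22 * v) ^+ 2.
have c0 : 0 <= c by rewrite mulr_ge0// sqr_ge0.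
pose iq : R := (beta ^+ 2)^-1.
have iq0 : 0 <= iq by rewrite invr_ge0 sqr_ge0.
have iq1 : iq < 1.
  by rewrite invf_lt1 ?exprn_gt0 ?beta_gt0// exprn_egt1// beta_gt1.
pose G := (1 - iq)^-1.
have G0 : 0 <= G by rewrite invr_ge0 subr_ge0 ltW.
have E0 : 0 <= 8 * (256 * D) * G.
  by apply: mulr_ge0 G0; apply: mulr_ge0 (ler0n _ _) _; apply: mulr_ge0 D0; exact: ler0n.
have F0 : 0 <= 8 * (256 * D).
  by apply: mulr_ge0 (ler0n _ _) _; apply: mulr_ge0 D0; exact: ler0n.
pose C4 := 8 * (256 + 8 * (256 * D) * G + 64 * K + 8 * (256 * D)) + 4 * v.
have C40 : 0 < C4.
  have h256 : 0 <= 256 :> R by exact: ler0n.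
  by rewrite /C4; move: (256 : R) (8 * (256 * D) * G) (8 * (256 * D)) h256 E0 F0 => x y z; lra.
(* [128 * c] is the cost [8 * 2 * c] of the threshold times the 8 of [lam_le_pk]; 16 covers
   [8 * kh <= 16 * pk kh] when [kh] is large. *)
exists (128 * c + 16), C4; split => //; first by rewrite ltr_wpDl// mulr_ge0.
move=> n d T P Z s k th s0 HM kn thk.
have [g [iZ2 Zv Zg gK]] := HK _ _ _ _ _ _ (ltn0Sn n) s0 HM.
have [mZ ind iZ0 _] := HM.
have iZ i : itg P (fun w => Z i w / s).
  have [i1 _] := iZ0 i; have := itgZ s^-1 i1.
  by under [X in itg P X -> _]funext do rewrite mulrC.
have EZ i : \int[P]_w (Z i w / s) = 0.
  have [i1 e1] := iZ0 i.
  under [X in Rintegral _ _ X]funext do rewrite mulrC.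
  by rewrite (ExZ _ i1) /Rintegral e1 mulr0.
have [a [mu [a0 ak am mm thE]]] := ThetaUpP thk.
have aj j : (j < k)%N -> (a j.+1 <= n.+1)%N.
  by move=> jk; rewrite -ak; apply: chain_leq am _; rewrite jk leqnn.
pose m j := (a j.+1 - a j)%N.
pose rho j := if (m j == 0)%N then 0%N else (trunc_log 2 (m j)).+1.
have mrho j : (m j < 2 ^ rho j)%N.
  rewrite /rho; case: eqVneq => [->//|m0]; exact: trunc_log_ltn.
have srho := sum_levels_le kn a0 ak am (fun j => erefl (rho j)).
pose el j p : 'I_n.+1 := inord (a j + p).
pose er j p : 'I_n.+1 := inord (a j + (m j - p.+1)).
have injl j : (j < k)%N -> {in gtn (m j) &, injective (el j)}.
  by move=> jk; exact: inord_injl (aj j jk).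
have injr j : (j < k)%N -> {in gtn (m j) &, injective (er j)}.
  by move=> jk; exact: inord_injr (aj j jk).
(* The zero default for [j >= k] keeps the chosen functions nonnegative for all indices, as
   [all_blocks_bound] asks. *)
have /choice[ABl HABl] : forall jr : nat * nat, exists f : (T -> R) * (T -> R),
    ((forall w, 0 <= f.1 w) /\ (forall w, 0 <= f.2 w)) /\ ((jr.1 < k)%N ->
    level_data P v (g jr.2) jr.2 (m jr.1) (fun p w => Z (el jr.1 p) w / s) f.1 f.2).
  move=> [j r] /=.
  case: (ltnP j k) => jk; last by exists (cst 0, cst 0); split.
  by have [f Hf] := block_level v1 mZ ind iZ EZ iZ2 Zv Zg r (injl j jk); exists f; case: (Hf).
have /choice[ABr HABr] : forall jr : nat * nat, exists f : (T -> R) * (T -> R),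
    ((forall w, 0 <= f.1 w) /\ (forall w, 0 <= f.2 w)) /\ ((jr.1 < k)%N ->
    level_data P v (g jr.2) jr.2 (m jr.1) (fun p w => Z (er jr.1 p) w / s) f.1 f.2).
  move=> [j r] /=.
  case: (ltnP j k) => jk; last by exists (cst 0, cst 0); split.
  by have [f Hf] := block_level v1 mZ ind iZ EZ iZ2 Zv Zg r (injr j jk); exists f; case: (Hf).
pose Al j r := (ABl (j, r)).1. pose Bl j r := (ABl (j, r)).2.
pose Ar j r := (ABr (j, r)).1. pose Br j r := (ABr (j, r)).2.
have Hl j r : (j < k)%N -> level_data P v (g r) r (m j) (fun p w => Z (el j p) w / s) (Al j r) (Bl j r).
  by have [_] := HABl (j, r).
have Hr j r : (j < k)%N -> level_data P v (g r) r (m j) (fun p w => Z (er j p) w / s) (Ar j r) (Br j r).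
  by have [_] := HABr (j, r).
pose N := n.+1. pose L : R := Lk N k. pose l : R := lam N k.
have l2 : 2^-1 <= l by exact: lam_ge.
have [_ L2] : _ /\ 2 <= L := Lk_ge kn.
have k0 : 0 < k%:R :> R by rewrite ltr0n; case/andP: kn.
(* A deterministic upper bound for [1 / q] in the case of large [kh] below. Its decay in [L] beats
   the factor [L] from the number of scales, so [y * QA] has mean [O(k)]. *)
pose y := 4 * L / expR (L / 2).
have y0 : 0 <= y by rewrite divr_ge0 ?expR_ge0// mulr_ge0//; lra.
pose ss (f h : nat -> nat -> T -> R) w := \sum_(0 <= j < k) \sum_(0 <= r < rho j) (f j r w + h j r w).
pose Qe := ss (fun j r w => Num.max (Al j r w - c * l) 0) (fun j r w => Num.max (Ar j r w - c * l) 0).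
pose QB := ss Bl Br.
pose QA := ss (fun j r w => Al j r w ^+ 2) (fun j r w => Ar j r w ^+ 2).
pose S w := \sum_(0 <= p < N) Z (inord p) w / s.
pose Q w := 8 * (Qe w + QB w + y * QA w) + 4 / N%:R * S w ^+ 2.
have sconst (x : R) : \sum_(0 <= j < k) \sum_(0 <= r < rho j) x = x * \sum_(0 <= j < k) (rho j)%:R.
  rewrite mulr_sumr; apply: eq_bigr => j _.
  by rewrite big_const_nat iter_addr_0 subn0 mulr_natr.
exists Q.
- have mE : mean_le P Qe ((256 + 8 * (256 * D) * G) * k%:R).
    have := @mean_le_sum _ _ _ P k _ _ (fun j jk => @mean_le_sum _ _ _ P (rho j) _ _
      (fun r _ => mean_leD (let: And5 _ _ _ _ h := Hl j r jk in h l l2)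
                           (let: And5 _ _ _ _ h := Hr j r jk in h l l2))).
    apply: mean_leW.
    apply: (@le_trans _ _ (\sum_(0 <= j < k) \sum_(0 <= r < rho j) (128 * expR (- l)) +
        \sum_(0 <= j < k) (8 * (256 * D) * \sum_(0 <= r < rho j) iq ^+ r))).
      rewrite -big_split/=; apply: ler_sum => j _; rewrite mulr_sumr -big_split/=.
      apply: ler_sum => r _.
      rewrite (_ : iq ^+ r = ((beta ^+ r) ^+ 2)^-1); last by rewrite /iq exprVn exprAC.
      rewrite -/D; move: (256 : R) ((beta ^+ r) ^+ 2)^-1 => x1 x2; lra.
    rewrite sconst [leRHS]mulrDl; apply: lerD.
      (* The iterated logarithm is the right threshold because [expR (- lam) = 1 / L] cancels the
         [L] in the number of scales. *)
      rewrite (expRN_lam kn) -/L.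
      apply: (@le_trans _ _ (128 * L^-1 * (2 * k%:R * L))).
        by apply: ler_wpM2l; [apply: mulr_ge0 => //; rewrite invr_ge0; lra|exact: srho].
      rewrite (_ : _ * _ = 128 * 2 * k%:R); last by field; rewrite gt_eqF//; lra.
      by rewrite -natrM.
    apply: (@le_trans _ _ (\sum_(0 <= j < k) 8 * (256 * D) * G)).
      apply: ler_sum => j _; apply: ler_wpM2l; first exact: F0.
      by apply: geometric_sum_le; rewrite iq0.
    by rewrite big_const_nat iter_addr_0 subn0 mulr_natr.
  have mB : mean_le P QB (64 * K * k%:R).
    have := @mean_le_sum _ _ _ P k _ _ (fun j jk => @mean_le_sum _ _ _ P (rho j) _ _
      (fun r _ => mean_leD (let: And5 _ _ h _ _ := Hl j r jk in h)
                           (let: And5 _ _ h _ _ := Hr j r jk in h))).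
    apply: mean_leW.
    apply: (@le_trans _ _ (\sum_(0 <= j < k) 64 * K)).
      apply: ler_sum => j _; rewrite (_ : \sum_(0 <= r < _) _ = 64 * \sum_(0 <= r < rho j) g r).
        by rewrite ler_pM2l.
      by rewrite mulr_sumr; apply: eq_bigr => r _; ring.
    by rewrite big_const_nat iter_addr_0 subn0 mulr_natr.
  have mA : mean_le P (fun w => y * QA w) (8 * (256 * D) * k%:R).
    have HA := @mean_le_sum _ _ _ P k _ _ (fun j jk => @mean_le_sum _ _ _ P (rho j) _ _
      (fun r _ => mean_leD (let: And5 _ _ _ h _ := Hl j r jk in h)
                           (let: And5 _ _ _ h _ := Hr j r jk in h))).
    apply: mean_leW (mean_leZ y0 HA).
    rewrite sconst -/D.
    apply: (@le_trans _ _ (y * ((16 * D + 16 * D) * (2 * k%:R * L)))).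
      by apply: ler_wpM2l => //; apply: ler_wpM2l; [lra|exact: srho].
    have L0 : 0 <= L by lra.
    have := sqr_le_expR_half L0.
    have ex := expR_gt0 (L / 2).
    rewrite /y mulrAC ler_pdivrMr// (_ : 4 * L * _ = 256 * D * k%:R * L ^+ 2); last first.
      by ring.
    move=> h; rewrite (_ : _ * expR _ = 256 * D * k%:R * (8 * expR (L / 2))); last by ring.
    apply: ler_wpM2l; last exact: h.
    apply: mulr_ge0; last exact: ltW.
    by apply: mulr_ge0 D0; exact: ler0n.
  have mS : mean_le P (fun w => 4 / N%:R * S w ^+ 2) (4 * v * k%:R).
    have HS := @sum_sq_mean _ _ _ P _ Z s v mZ ind iZ EZ iZ2 Zv (fun p => inord p) N.
    have {}HS := HS _; have inj : {in gtn N &, injective (fun p => inord p : 'I_n.+1)}.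
      by move=> p q; rewrite !inE => pm qm /(congr1 val); rewrite /= !inordK.
    have N0 : 0 < N%:R :> R by [].
    apply: mean_leW (mean_leZ _ (HS inj)); last by rewrite divr_ge0.
    rewrite mulrA divfK ?gt_eqF//; apply: ler_peMr; first by lra.
    by rewrite ler1n; case/andP: kn.
  have := mean_leD (mean_leZ (ler0n R 8) (mean_leD (mean_leD mE mB) mA)) mS.
  apply: mean_leW; rewrite /C4 le_eqVlt; apply/orP; left; apply/eqP.
  by move: (256 : R) => x; ring.
- move=> w kh t khn tkh.
  have Al0 j r : 0 <= Al j r w by have [[h _] _] := HABl (j, r); exact: h.
  have Bl0 j r : 0 <= Bl j r w by have [[_ h] _] := HABl (j, r); exact: h.
  have Ar0 j r : 0 <= Ar j r w by have [[h _] _] := HABr (j, r); exact: h.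
  have Br0 j r : 0 <= Br j r w by have [[_ h] _] := HABr (j, r); exact: h.
  have ss0 f h : (forall j r, 0 <= f j r w) -> (forall j r, 0 <= h j r w) -> 0 <= ss f h w.
    by move=> f0 h0; apply: sumr_ge0 => j _; apply: sumr_ge0 => r _; exact: addr_ge0.
  have ssle f h f' h' : (forall j r, f j r w <= f' j r w) -> (forall j r, h j r w <= h' j r w) ->
      ss f h w <= ss f' h' w.
    by move=> ff hh; apply: ler_sum => j _; apply: ler_sum => r _; exact: lerD.
  have ssD f h f' h' : ss (fun j r w => f j r w + f' j r w) (fun j r w => h j r w + h' j r w) w
      = ss f h w + ss f' h' w.
    rewrite /ss -big_split/=; apply: eq_bigr => j _; rewrite -big_split/=.
    by apply: eq_bigr => r _; rewrite addrACA.
  have ssZ (x : R) f h : ss (fun j r w => x * f j r w) (fun j r w => x * h j r w) w = x * ss f h w.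
    rewrite /ss mulr_sumr; apply: eq_bigr => j _; rewrite mulr_sumr.
    by apply: eq_bigr => r _; rewrite mulrDr.
  have max0 (x : R) : 0 <= Num.max x 0 by rewrite le_max lexx orbT.
  have Qe0 : 0 <= Qe w by apply: ss0 => j r; exact: max0.
  have QB0 : 0 <= QB w by exact: ss0.
  have QA0 : 0 <= QA w by apply: ss0 => j r; exact: sqr_ge0.
  have yQA0 : 0 <= y * QA w by exact: mulr_ge0.
  have N0 : 0 < N%:R :> R by [].
  have S0 : 0 <= 4 / N%:R * S w ^+ 2 by rewrite mulr_ge0 ?sqr_ge0// divr_ge0.
  have pk0 := pk_ge0 (R := R) kn; have pkh0 := pk_ge0 (R := R) khn.
  have conv (f : 'I_n.+1 -> R) : \sum_i f i = \sum_(0 <= i < N) f (inord i).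
    by rewrite big_mkord; apply: eq_bigr => i _; rewrite inord_val.
  rewrite !conv.
  have main u : 0 <= u ->
    2 * \sum_(0 <= i < N) (t (inord i) - th (inord i)) * (Z (inord i) w / s) <=
    4^-1 * \sum_(0 <= i < N) (t (inord i) - th (inord i)) ^+ 2 +
    8 * (2 * u * (k%:R + kh%:R) +
      ss (fun j r w => Num.max (Al j r w + Bl j r w - u) 0)
         (fun j r w => Num.max (Ar j r w + Br j r w - u) 0) w).
    move=> u0.
    apply: (@all_blocks_bound _ N k kh a (fun i => t (inord i)) (fun i => th (inord i))
      (fun i => Z (inord i) w / s) mu rho (fun j r => Al j r w + Bl j r w)
      (fun j r => Ar j r w + Br j r w) u) => //.
    - by move=> i iN; exact: ThetaUp_nondecreasing tkh iN.
    - exact: ThetaUp_jumps.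
    - by move=> j _; exact: mrho.
    - by move=> j r; exact: addr_ge0.
    - by move=> j r; exact: addr_ge0.
    - move=> j r q jk _ qm q2; have [_ h _ _ _] := Hl j r jk.
      exact: h.
    - move=> j r q jk _ qm q2; have [_ h _ _ _] := Hr j r jk.
      exact: h.
  (* Both vectors are constant here: one AM-GM against the total sum [S] replaces the dyadic
     bound. *)
  have [/andP[/eqP k1 /eqP kh1]|n1] := boolP ((k == 1%N) && (kh == 1%N)).
    have cst1 (t' : 'I_n.+1 -> R) : ThetaUp 1 t' -> exists x, forall i, (i < N)%N -> t' (inord i) = x.
      move=> /ThetaUpP[a' [mu' [a0' ak' _ _ H']]]; exists (mu' 0%N) => i iN.
      by apply: (H' 0%N i) => //; rewrite a0' ak'.
    have [x tx] : exists x, forall i, (i < N)%N -> t (inord i) = x.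
      by apply: cst1; rewrite -kh1.
    have [x' tx'] : exists x, forall i, (i < N)%N -> th (inord i) = x.
      by apply: cst1; rewrite -k1.
    have -> : \sum_(0 <= i < N) (t (inord i) - th (inord i)) * (Z (inord i) w / s) = (x - x') * S w.
      rewrite mulr_sumr; apply: eq_big_nat => i /andP[_ iN].
      by rewrite tx// tx'.
    have -> : \sum_(0 <= i < N) (t (inord i) - th (inord i)) ^+ 2 = N%:R * (x - x') ^+ 2.
      rewrite (eq_big_nat _ _ (F2 := fun=> (x - x') ^+ 2)).
        by rewrite big_const_nat iter_addr_0 subn0 mulr_natl.
      by move=> i /andP[_ iN]; rewrite tx// tx'.
    have AMGM : 2 * ((x - x') * S w) <= 4^-1 * (N%:R * (x - x') ^+ 2) + 4 / N%:R * S w ^+ 2.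
      rewrite [4 / _ * _]mulrAC -lerBlDl ler_pdivlMr//.
      by have := sqr_ge0 (N%:R * (x - x') - 4 * S w); move: (N%:R : R) (x - x') (S w) => A B C; lra.
    have : 0 <= (128 * c + 16) * (pk n.+1 k + pk n.+1 kh).
      by apply: mulr_ge0; [apply: addr_ge0 => //; apply: mulr_ge0|apply: addr_ge0].
    rewrite /Q; move: ((128 * c + 16) * _) => x1; lra.
  have [khk|khk] := leP (kh%:R : R) (k%:R * expR (L / 2)).
    have h1 := main (c * l) _; have {h1} := h1 (mulr_ge0 c0 _).
    have l0 : 0 <= l by lra.
    move=> /(_ l0) h1.
    have h2 : l * (k%:R + kh%:R) <= 8 * (pk N k + pk N kh) by exact: lam_le_pk.
    have h3 : c * (l * (k%:R + kh%:R)) <= c * (8 * (pk N k + pk N kh)) by exact: ler_wpM2l.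
    have h4 : ss (fun j r w => Num.max (Al j r w + Bl j r w - c * l) 0)
         (fun j r w => Num.max (Ar j r w + Br j r w - c * l) 0) w <= Qe w + QB w.
      by rewrite /Qe /QB -ssD; apply: ssle => j r; exact: max_addr_le.
    rewrite /Q; move: h1 h2 h3 h4.
    move: (ss _ _ w) (Qe w) (QB w) (y * QA w) (4 / N%:R * S w ^+ 2) Qe0 QB0 yQA0 S0 => x1 x2 x3 x4 x5.
    move: (\sum_(0 <= i < N) _) (\sum_(0 <= i < N) _) (pk N k) (pk N kh) pk0 pkh0 => x6 x7 x8 x9.
    move=> *; lra.
  have := main 0 (lexx 0); rewrite mulr0 mul0r add0r => h1.
  have kh0 : 0 < kh%:R :> R by rewrite ltr0n; case/andP: khn.
  have L0 : 0 < L by lra.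
  (* Chosen so that [q], spent once on each side at each of the at most [2 k L] scales, totals at
     most [kh]. *)
  pose q := kh%:R / (4 * k%:R * L).
  have q0 : 0 < q by rewrite divr_gt0// !mulr_gt0.
  have qy : q^-1 <= y.
    rewrite /q /y invf_div ler_pdivrMr// [leRHS]mulrAC ler_pdivlMr ?expR_gt0//.
    rewrite (_ : 4 * k%:R * L * expR (L / 2) = 4 * L * (k%:R * expR (L / 2))); last by ring.
    by apply: ler_wpM2l; [apply: mulr_ge0 => //; exact: ltW|exact: ltW].
  have Aq (A : R) : 0 <= A -> A <= q + y * A ^+ 2.
    move=> A0; apply: (@le_trans _ _ (q + q^-1 * A ^+ 2)); last first.
      by rewrite lerD2l; apply: ler_wpM2r => //; exact: sqr_ge0.
    rewrite [q^-1 * _]mulrC -lerBlDl ler_pdivlMr//.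
    by have := sqr_ge0 (q - A); have := mulr_ge0 (ltW q0) A0; lra.
  have h4 : ss (fun j r w => Num.max (Al j r w + Bl j r w - 0) 0)
       (fun j r w => Num.max (Ar j r w + Br j r w - 0) 0) w <= kh%:R + y * QA w + QB w.
    apply: (@le_trans _ _ (ss (fun j r w => (q + y * Al j r w ^+ 2) + Bl j r w)
       (fun j r w => (q + y * Ar j r w ^+ 2) + Br j r w) w)).
      by apply: ssle => j r; rewrite subr0 max_l ?addr_ge0// lerD2r; exact: Aq.
    rewrite (ssD (fun j r w => q + y * Al j r w ^+ 2) (fun j r w => q + y * Ar j r w ^+ 2)).
    rewrite lerD2r (ssD (fun _ _ _ => q) (fun _ _ _ => q)) ssZ lerD2r.
    rewrite /ss sconst; apply: (@le_trans _ _ ((q + q) * (2 * k%:R * L))).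
      by apply: ler_wpM2l; [exact: addr_ge0 (ltW q0) (ltW q0)|exact: srho].
    rewrite /q (_ : _ * _ = kh%:R)//; field.
    by rewrite !gt_eqF.
  have h5 := pk_ge (R := R) khn.
  have h6 : 0 <= c * (pk N k + pk N kh) by exact: mulr_ge0 c0 (addr_ge0 pk0 pkh0).
  rewrite /Q; move: h1 h4 h5 h6.
  move: (ss _ _ w) (Qe w) (QB w) (y * QA w) (4 / N%:R * S w ^+ 2) Qe0 QB0 yQA0 S0 => x1 x2 x3 x4 x5.
  move: (\sum_(0 <= i < N) _) (\sum_(0 <= i < N) _) (pk N k) (pk N kh) pk0 pkh0 => x6 x7 x8 x9.
  move=> *; lra.
Qed.

(** * From the noise bound to the risk bound *)

Section sqdist_facts.
Context {R : realType} (n : nat).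
Implicit Types x y z : 'I_n -> R.

Lemma sqdistC x y : sqdist x y = sqdist y x.
Proof. by apply: eq_bigr => i _; rewrite -sqrrN opprB. Qed.

Lemma sqdist_ge0 x y : 0 <= sqdist x y.
Proof. by apply: sumr_ge0 => i _; exact: sqr_ge0. Qed.

Lemma sqdist_le2 x y z : sqdist x z <= 2 * (sqdist x y + sqdist z y).
Proof.
rewrite /sqdist -big_split/= mulr_sumr; apply: ler_sum => i _.
by have := sqr_ge0 ((x i - y i) + (z i - y i)); nra.
Qed.

Lemma sqdist_noise (x t u e : 'I_n -> R) :
  sqdist (fun i => x i + e i) t - sqdist (fun i => x i + e i) u =
  sqdist t x - sqdist u x - 2 * \sum_i (t i - u i) * e i.
Proof.
rewrite /sqdist mulr_sumr -!sumrB; apply: eq_bigr => i _; ring.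
Qed.

Lemma ThetaUp_scale k (c : R) x : 0 <= c -> ThetaUp k x ->
  ThetaUp k (fun i => c * x i).
Proof.
move=> c0 [a [mu [a0 ak am mm H]]]; exists a, (fun j => c * mu j); split => //.
- by move=> j j1 jk; rewrite ler_wpM2l// mm.
- by move=> j i jk ij; rewrite (H j).
Qed.

Lemma approx_err_attained k (th x : 'I_n -> R) : ThetaUp k th ->
  (forall th', ThetaUp k th' -> sqdist x th <= sqdist x th') ->
  sqdist th x <= approx_err k x.
Proof.
move=> thk H; apply: lb_le_inf; first by exists (sqdist th x), th.
by move=> _ [th' [th'k ->]]; rewrite sqdistC [leRHS]sqdistC; exact: H.
Qed.

End sqdist_facts.

Theorem mainTheorem4 (R : realType) (eps C1 : R) :
  0 < eps < 1 -> 0 < C1 ->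
  exists Cp C : R, 0 < Cp /\ 0 < C /\
  forall (n : nat) (d : measure_display) (T : measurableType d)
         (P : probability T R) (Z : 'I_n -> T -> R) (sigma : R)
         (thstar : 'I_n -> R)
         (thk : nat -> ('I_n -> R) -> ('I_n -> R))
         (khat : ('I_n -> R) -> nat),
    (0 < n)%N -> 0 < sigma ->
    condM P Z sigma eps C1 ->
    let tau := Cp * sigma ^+ 2 in
    (* thk k x is a least-squares fit of x over Theta_k^up *)
    (forall k x, (1 <= k <= n)%N ->
       ThetaUp k (thk k x) /\
       forall th, ThetaUp k th -> sqdist x (thk k x) <= sqdist x th) ->
    (* khat x minimizes the penalized criterion over k in [n] *)
    (forall x, (1 <= khat x <= n)%N /\
       forall k, (1 <= k <= n)%N ->
         sqdist x (thk (khat x) x) + pen tau n (khat x)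
           <= sqdist x (thk k x) + pen tau n k) ->
    let X := fun w (i : 'I_n) => thstar i + Z i w in
    let thhat := fun w => thk (khat (X w)) (X w) in
    measurable_fun setT (fun w => sqdist (thhat w) thstar) ->
    forall k, (1 <= k <= n)%N ->
      (\int[P]_w (sqdist (thhat w) thstar)%:E
         <= (C * (approx_err k thstar + pen tau n k))%:E)%E.
Proof.
move=> /andP[e0 _] C0; have [C3 [C4 [C30 C40 HN]]] := noise_bound e0 C0.
(* With [Cp = C3] the [khat] share of the noise bound is exactly the penalty of [khat], and the two
   cancel. *)
exists C3, (7 + 4 * C4 / C3); split => //; split.
  by rewrite addr_gt0// divr_gt0// mulr_gt0.
case=> [//|n] d T P Z s thstar thk khat _ s0 HM tau Hthk Hkhat X thhat mth k kn.
have s20 : 0 < s ^+ 2 by rewrite exprn_gt0.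
have [thK thmin] := Hthk k thstar kn.
pose th := thk k thstar.
have si0 : 0 <= s^-1 by rewrite invr_ge0 ltW.
have [Q [iQ EQ] HQ] := HN _ _ _ _ _ _ _ _ s0 HM kn (ThetaUp_scale si0 thK).
have ae : sqdist th thstar <= approx_err k thstar by exact: approx_err_attained.
have pk0 := pk_ge0 (R := R) kn; have pk1 := pk_ge (R := R) kn.
(* The quarter of [sqdist thhat th] is at most half of [sqdist thhat thstar + sqdist th thstar].
   Moving the risk to the left doubles the rest, hence 3, 4 and 2. *)
have path w : sqdist (thhat w) thstar <=
    3 * sqdist th thstar + 4 * (tau * pk n.+1 k) + 2 * s ^+ 2 * Q w.
  have [khn kmin] := Hkhat (X w).
  have [tK _] := Hthk (khat (X w)) (X w) khn.
  have [_ xmin] := Hthk k (X w) kn.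
  have basic : sqdist (X w) (thhat w) + tau * pk n.+1 (khat (X w)) <=
      sqdist (X w) th + tau * pk n.+1 k.
    have := le_trans (kmin k kn) (lerD (xmin th thK) (lexx _)).
    by rewrite !pen_pk.
  have noise : sqdist (X w) (thhat w) - sqdist (X w) th = sqdist (thhat w) thstar -
      sqdist th thstar - 2 * \sum_i (thhat w i - th i) * Z i w.
    exact: sqdist_noise.
  have := HQ w (khat (X w)) _ khn (ThetaUp_scale si0 tK).
  have -> : \sum_i (s^-1 * thk (khat (X w)) (X w) i - s^-1 * thk k thstar i) * (Z i w / s) =
      (s ^+ 2)^-1 * \sum_i (thhat w i - th i) * Z i w.
    rewrite mulr_sumr; apply: eq_bigr => i _; rewrite /thhat /th; field.
    by rewrite gt_eqF.
  have -> : \sum_i (s^-1 * thk (khat (X w)) (X w) i - s^-1 * thk k thstar i) ^+ 2 =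
      (s ^+ 2)^-1 * sqdist (thhat w) th.
    rewrite mulr_sumr; apply: eq_bigr => i _; rewrite /thhat /th; field.
    by rewrite gt_eqF.
  rewrite -(ler_pM2l s20) => h.
  have {}h : 2 * \sum_i (thhat w i - th i) * Z i w <= 4^-1 * sqdist (thhat w) th +
      tau * (pk n.+1 k + pk n.+1 (khat (X w))) + s ^+ 2 * Q w.
    apply: (le_trans _ (le_trans h _)); rewrite le_eqVlt; apply/orP; left; apply/eqP.
      by field; rewrite gt_eqF.
    by rewrite /tau; field; rewrite gt_eqF.
  have tri := sqdist_le2 (thhat w) thstar th.
  move: basic noise h tri.
  move: (\sum_i _) (sqdist (X w) (thhat w)) (sqdist (X w) th) (sqdist (thhat w) thstar).
  move: (sqdist th thstar) (sqdist (thhat w) th) (s ^+ 2 * Q w) (2 * s ^+ 2 * Q w) (mulrA 2 (s ^+ 2) (Q w)).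
  by move=> *; lra.
have iB : itg P (fun w => 3 * sqdist th thstar + 4 * (tau * pk n.+1 k) + 2 * s ^+ 2 * Q w).
  by apply: itgD; [exact: itg_cst|exact: itgZ].
apply: (@le_trans _ _ (\int[P]_w (3 * sqdist th thstar + 4 * (tau * pk n.+1 k) + 2 * s ^+ 2 * Q w)%:E)%E).
  apply: ge0_le_integral => //.
  - by move=> w _; rewrite lee_fin sqdist_ge0.
  - exact/measurable_EFinP.
  - exact: measurable_int iB.
  - by move=> w _; rewrite lee_fin; exact: path.
rewrite itg_integral// lee_fin (ExD (itg_cst P _) (itgZ _ iQ)) Ex_cst (ExZ _ iQ) pen_pk.
have sd0 := sqdist_ge0 th thstar.
have t0 : 0 < tau by rewrite mulr_gt0.
have h1 : 2 * s ^+ 2 * \int[P]_w Q w <= 4 * C4 / C3 * (tau * pk n.+1 k).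
  apply: (@le_trans _ _ (2 * s ^+ 2 * (C4 * (2 * pk n.+1 k)))).
    apply: ler_wpM2l; first by rewrite mulr_ge0// ltW.
    by apply: (le_trans EQ); apply: ler_wpM2l => //; exact: ltW.
  rewrite le_eqVlt; apply/orP; left; apply/eqP.
  by rewrite /tau; field; rewrite gt_eqF.
have r0 : 0 <= 4 * C4 / C3 by rewrite divr_ge0 ?mulr_ge0// ltW.
have tp0 : 0 <= tau * pk n.+1 k by rewrite mulr_ge0// ltW.
move: (approx_err k thstar) ae h1 => x ae.
move: (2 * s ^+ 2 * \int[P]_w Q w) (4 * C4 / C3) r0 (tau * pk n.+1 k) tp0 => y1 y2 r0 y3 y30 h1.
have := mulr_ge0 r0 (le_trans sd0 ae); nra.
Qed.
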